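(* Assume (A1)–(A7) and (P), as listed in the context. Then, as $n\to\infty$, \[ \sqrt{k_n}\,\big(\hat\theta_n^{B,dj}-\hat\theta_n^{N,dj}\big)=o_{\mathbb P}(1)\qquad\text{and}\qquad \sqrt{k_n}\,\big(\hat\theta_n^{B,sl}-\hat\theta_n^{N,sl}\big)=o_{\mathbb P}(1). \]
   Context: Setting. $(X_s)_{s\ge1}$ is a stationary sequence of real-valued random variables with continuous marginal cdf $F$; $U_s=F(X_s)$. For $s\le t$ let $N_{s:t}=\max\{U_s,\dots,U_t\}$, and $Z_{1:m}=m(1-N_{1:m})$. The sample $X_1,\dots,X_n$ is divided into $k_n$ blocks of length $b_n$, $n=b_nk_n$, $k_n\to\infty$. All limits are for $n\to\infty$. Estimators. $\hat F_n(x)=n^{-1}\sum_{s=1}^n\mathbf 1(X_s\le x)$. Disjoint blocks, $i=1,\dots,k_n$: $M_{ni}=\max\{X_{(i-1)b_n+1},\dots,X_{ib_n}\}$, $\hat N_{ni}=\hat F_n(M_{ni})$, $\hat Z_{ni}=b_n(1-\hat N_{ni})$, $\hat Y_{ni}=-b_n\log\hat N_{ni}$, and $\hat\theta_n^{B,dj}=(k_n^{-1}\sum_{i=1}^{k_n}\hat Z_{ni})^{-1}$, $\hat\theta_n^{N,dj}=(k_n^{-1}\sum_{i=1}^{k_n}\hat Y_{ni})^{-1}$. Sliding blocks, $t=1,\dots,n-b_n+1$: $M^{sl}_{nt}=\max\{X_t,\dots,X_{t+b_n-1}\}$, $\hat N^{sl}_{nt}=\hat F_n(M_{nt}^{sl})$,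 $\hat Z^{sl}_{nt}=b_n(1-\hat N^{sl}_{nt})$, $\hat Y^{sl}_{nt}=-b_n\log\hat N^{sl}_{nt}$, and $\hat\theta_n^{B,sl}=\big(\frac1{n-b_n+1}\sum_{t}\hat Z^{sl}_{nt}\big)^{-1}$, $\hat\theta_n^{N,sl}=\big(\frac1{n-b_n+1}\sum_{t}\hat Y^{sl}_{nt}\big)^{-1}$. Extremal index. $(X_s)$ has extremal index $\theta$ if for any $\tau>0$ there is a sequence $u_n=u_n(\tau)$ with $n(1-F(u_n))\to\tau$ and $\mathbb P(\max(X_1,\dots,X_n)\le u_n)\to e^{-\theta\tau}$. Point process of exceedances. For Borel $A\subset E:=(0,1]$ and $x\ge0$: $N_n^{(x)}(A)=\sum_{s=1}^n\mathbf 1(s/n\in A,\,U_s>1-x/n)$. Separating sequences. For $x_1\ge\dots\ge x_m\ge0$, $\mathcal F_{p:q,n}$ is the sigma-algebra generated by the events $\{U_i>1-x_j/n\}$, $p\le i\le q$, $1\le j\le m$, and $\alpha_{n,\ell}(x_1,\dots,x_m)=\sup\{|\mathbb P(A\cap B)-\mathbb P(A)\mathbb P(B)|: A\in\mathcal F_{1:s,n},B\in\mathcal F_{s+\ell:n,n},1\le s\le n-\ell\}$. The condition $\Delta_n(x_1,\dots,x_m)$ holds if $\alpha_{n,\ell_n}(x_1,\dots,x_m)=o(1)$ for some $\ell_n=o(n)$. A sequence $q_n=o(n)$ is $\Delta_n(x_1,\dots,x_m)$-separating if there is $\ell_n=o(q_n)$ with $nq_n^{-1}\alpha_{n,\ell_n}(x_1,\dots,x_m)=o(1)$.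 Put $B_n=(0,q_n/n]$. Mixing coefficients. $\alpha(\mathcal F_1,\mathcal F_2)=\sup_{A\in\mathcal F_1,B\in\mathcal F_2}|\mathbb P(A\cap B)-\mathbb P(A)\mathbb P(B)|$. For $\varepsilon\in(0,1]$, $\mathcal B^\varepsilon_{p:q}$ is the sigma-algebra generated by $U_s\mathbf 1(U_s>1-\varepsilon)$, $p\le s\le q$, and $\alpha_\varepsilon(\ell)=\sup_{k\in\mathbb N}\alpha(\mathcal B^\varepsilon_{1:k},\mathcal B^\varepsilon_{k+\ell:\infty})$. Assumptions. (A1) The extremal index $\theta\in(0,1]$ exists. $\Delta_n(x_1,x_2)$ holds for all $x_1\ge x_2\ge0$, $x_1\ne0$ (and $\Delta_n(x)$ for all $x>0$). There is a probability distribution $\pi$ on $\{1,2,\dots\}$ with $\mathbb P(N_n^{(x)}(B_n)=j\mid N_n^{(x)}(B_n)>0)\to\pi(j)$ for all $x>0$, $j\ge1$, for some $\Delta_n(x)$-separating sequence $q_n$. There is a family of probability measures $\{\pi_2^{(\sigma)}:\sigma\in[0,1]\}$ on $\mathcal J=\{(i,j):i\ge j\ge0,i\ge1\}$ with $\mathbb P(N_n^{(x_1)}(B_n)=i,N_n^{(x_2)}(B_n)=j\mid N_n^{(x_1)}(B_n)>0)\to\pi_2^{(x_2/x_1)}(i,j)$ for all $(i,j)\in\mathcal J$, $x_1\ge x_2\ge0$, $x_1\neq0$, for some $\Delta_n(x_1,x_2)$-separating sequence $q_n$. (A2) There is $\delta>0$ such that for any $\ell>0$ there is a constant $C'_\ell$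 with $\mathrm E[|N_n^{(x_1)}(E)-N_n^{(x_2)}(E)|^{2+\delta}]\le C'_\ell(x_1-x_2)$ for all $\ell\ge x_1\ge x_2\ge0$, $n\in\mathbb N$. (A3) There are $c_2\in(0,1)$, $C_2>0$ with $\alpha_{c_2}(\ell)\le C_2\ell^{-\eta}$ for some $\eta\ge3(2+\delta)/(\delta-\mu)>3$, where $0<\mu<\min(\delta,1/2)$ and $\delta$ is from (A2). Moreover $b_n\to\infty$, $k_n=o(b_n^2)$, and there is a sequence $\ell_n\to\infty$ with $\ell_n=o(b_n^{2/(2+\delta)})$ and $k_n\alpha_{c_2}(\ell_n)=o(1)$. (A4) There are $c_1\in(0,1)$, $C_1>0$ such that $\mathrm{Var}\{\sum_{s=1}^n\mathbf 1(U_s>1-y)\}\le C_1(ny+n^2y^2)$ for all $y\in(0,c_1)$, $n\in\mathbb N$. (A5) For all $c\in(0,1)$, $\mathbb P(\min_{i=1}^{2k_n}N'_{ni}\le c)\to0$, where $N'_{ni}=\max\{U_s:s\in[(i-1)b_n/2+1,\,ib_n/2]\}$. (A6) $\limsup_{n\to\infty}\mathrm E[Z_{1:n}^{2+\delta}]<\infty$ with $\delta$ from (A2). (A7) $\mathrm E[Z_{1:b_n}]=\theta^{-1}+o(k_n^{-1/2})$. (P) For any $x>0$: $\lim_{m\to\infty}\limsup_{n\to\infty}\mathbb P(N_{m:b_n}>1-\frac xn\mid U_1\ge1-\frac xn)=0$. *)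

(* Defs.v *)
From HB Require Import structures.
From mathcomp Require Import all_boot all_order all_algebra.
From mathcomp Require Import all_classical all_reals all_analysis.

Set Implicit Arguments.
Unset Strict Implicit.
Unset Printing Implicit Defensive.

Import Order.TTheory GRing.Theory Num.Theory.
Import numFieldNormedType.Exports.

Local Open Scope classical_set_scope.
Local Open Scope ring_scope.

(* The process is (X_s)_{s >= 1}: the variable [X 0] exists for typing reasons
   only and is never constrained.
   The divisions n = b_n k_n with b_n, k_n -> oo cannot hold for every n (take n
   prime), so the sample sizes n range over an infinite set S, and limits of
   quantities that depend on the blocks are taken along the filter
   [within S \oo].  Limits of quantities that depend only on the process are
   taken along all n. *)

Section Process.
Context {d : measure_display} {T : measurableType d} {R : realType}.
Variables (P : probability T R) (X : nat -> {RV P >-> R}).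

Definition Pr (A : set T) : R := fine (P A).

Definition cPr (A B : set T) : R := Pr (A `&` B) / Pr B.

Definition window (m h : nat) (w : T) : m.-tuple R :=
  [tuple X (h + i).+1 w | i < m].

Definition stationary : Prop :=
  forall (m h : nat) (A : set (m.-tuple R)), measurable A ->
    P (window m h @^-1` A) = P (window m 0 @^-1` A).

Definition F (x : R) : R := fine (cdf (X 1%N) x).

Definition U (s : nat) (w : T) : R := F (X s w).

(* Since U takes its values in [0, 1], the unit 0 of the maximum only matters
   for an empty range of indices. *)
Definition N (s t : nat) (w : T) : R :=
  \big[Num.max/0]_(s <= i < t.+1) U i w.

Definition Z (m : nat) (w : T) : R := m%:R * (1 - N 1 m w).

(* max {X_p, ..., X_{p + len - 1}}, for len >= 1 *)
Definition maxX (p len : nat) (w : T) : R :=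
  \big[Num.max/X p w]_(p <= s < p + len) X s w.

Definition extremal_index (theta : R) : Prop :=
  forall tau : R, 0 < tau -> exists u : nat -> R,
    n%:R * (1 - F (u n)) @[n --> \oo] --> tau /\
    Pr [set w | maxX 1 n w <= u n] @[n --> \oo] --> expR (- (theta * tau)).

Definition exceed (n : nat) (x : R) (A : set R) (w : T) : nat :=
  (\sum_(1 <= s < n.+1)
     (`[< A (s%:R / n%:R) >] && (1 - x / n%:R < U s w))%R)%N.

Definition E : set R := `]0, 1].

Definition mixing_gap (A B : set T) : R :=
  `| Pr (A `&` B) - Pr A * Pr B |.

Definition exceed_sigma (xs : seq R) (p q n : nat) : set (set T) :=
  <<s [set A | exists i x, [/\ (p <= i <= q)%N, x \in xs &
                            A = [set w | 1 - x / n%:R < U i w]]] >>.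

Definition alpha_seq (xs : seq R) (n l : nat) : R :=
  sup [set r | exists s A B, [/\ (1 <= s)%N /\ (s + l <= n)%N,
    exceed_sigma xs 1 s n A, exceed_sigma xs (s + l) n n B &
    r = mixing_gap A B]].

Definition Delta (xs : seq R) : Prop :=
  exists l : nat -> nat,
    (fun n => (l n)%:R : R) =o_\oo (fun n => n%:R : R) /\
    alpha_seq xs n (l n) @[n --> \oo] --> (0 : R).

Definition separating (xs : seq R) (q : nat -> nat) : Prop :=
  [/\ forall n, (0 < q n)%N,
      (fun n => (q n)%:R : R) =o_\oo (fun n => n%:R : R) &
      exists l : nat -> nat,
        (fun n => (l n)%:R : R) =o_\oo (fun n => (q n)%:R : R) /\
        n%:R / (q n)%:R * alpha_seq xs n (l n) @[n --> \oo] --> (0 : R)].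

Definition Bset (q : nat -> nat) (n : nat) : set R :=
  `]0, (q n)%:R / n%:R].

Definition mixing_alpha (F1 F2 : set (set T)) : R :=
  sup [set r | exists A B, [/\ F1 A, F2 B & r = mixing_gap A B]].

Definition tail_sigma (eps : R) (I : set nat) : set (set T) :=
  <<s \bigcup_(s in I) preimage_set_system [set: T]
        (fun w => U s w * (1 - eps < U s w)%R%:R) (@measurable _ R) >>.

Definition alpha_eps (eps : R) (l : nat) : R :=
  sup [set r | exists k : nat, (1 <= k)%N /\
    r = mixing_alpha (tail_sigma eps [set s | (1 <= s <= k)%N])
                     (tail_sigma eps [set s | (k + l <= s)%N])].

Definition A1 (theta : R) : Prop :=
  [/\ 0 < theta <= 1 /\ extremal_index theta,
      (forall x1 x2 : R, 0 <= x2 -> x2 <= x1 -> x1 != 0 -> Delta [:: x1; x2]),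
      (forall x : R, 0 < x -> Delta [:: x]),
      (exists pi : probability nat R,
         pi [set j | (1 <= j)%N] = 1%E /\
         forall x : R, 0 < x -> exists q, separating [:: x] q /\
           forall j, (1 <= j)%N ->
             cPr [set w | exceed n x (Bset q n) w = j]
                 [set w | (0 < exceed n x (Bset q n) w)%N]
               @[n --> \oo] --> fine (pi [set j])) &
      (exists pi2 : R -> probability (nat * nat)%type R,
         (forall sigma, 0 <= sigma <= 1 ->
            pi2 sigma [set ij | (ij.2 <= ij.1)%N /\ (1 <= ij.1)%N] = 1%E) /\
         forall x1 x2 : R, 0 <= x2 -> x2 <= x1 -> x1 != 0 ->
           exists q, separating [:: x1; x2] q /\
           forall i j, (j <= i)%N -> (1 <= i)%N ->
             cPr [set w | exceed n x1 (Bset q n) w = i /\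
                          exceed n x2 (Bset q n) w = j]
                 [set w | (0 < exceed n x1 (Bset q n) w)%N]
               @[n --> \oo] --> fine (pi2 (x2 / x1) [set (i, j)]))].

Definition A2 (delta : R) : Prop :=
  0 < delta /\
  forall l : R, 0 < l -> exists C : R,
    forall x1 x2 : R, 0 <= x2 -> x2 <= x1 -> x1 <= l ->
    forall n : nat, (1 <= n)%N ->
    ('E_P[fun w => (`|(exceed n x1 E w)%:R - (exceed n x2 E w)%:R|
                      `^ (2 + delta))%R]
      <= (C * (x1 - x2))%:E)%E.

Definition A4 : Prop :=
  exists c1 C1 : R, [/\ 0 < c1 < 1, 0 < C1 &
    forall (y : R) (n : nat), 0 < y < c1 -> (1 <= n)%N ->
    ('V_P[fun w => (\sum_(1 <= s < n.+1) (1 - y < U s w)%R%:R)%R]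
      <= (C1 * (n%:R * y + n%:R ^+ 2 * y ^+ 2))%:E)%E].

Definition A6 (delta : R) : Prop :=
  (limn_esup (fun n => 'E_P[fun w => (Z n w `^ (2 + delta))%R]) < +oo)%E.

Section Blocks.
Variables (S : set nat) (b k : nat -> nat).

Definition block_scheme : Prop :=
  [/\ infinite_set S,
      forall n, S n -> n = (b n * k n)%N &
      k n @[n --> within S \oo] --> \oo].

Definition A3 (delta : R) : Prop :=
  (exists c2 C2 mu eta : R,
    [/\ 0 < c2 < 1, 0 < C2,
        0 < mu < Num.min delta (1 / 2),
        3 * (2 + delta) / (delta - mu) <= eta &
        [/\ forall l : nat, (1 <= l)%N ->
              alpha_eps c2 l <= C2 * l%:R `^ (- eta),
            b n @[n --> within S \oo] --> \oo,
            (fun n => (k n)%:R : R) =o_ (within S \oo) (fun n => (b n)%:R ^+ 2 : R) &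
            exists l : nat -> nat,
              [/\ l n @[n --> within S \oo] --> \oo,
                  (fun n => (l n)%:R : R) =o_ (within S \oo)
                    (fun n => (b n)%:R `^ (2 / (2 + delta)) : R) &
                  (k n)%:R * alpha_eps c2 (l n)
                    @[n --> within S \oo] --> (0 : R)]]]).

(* N'_{ni}: the indices s are the integers of the real interval
   [(i - 1) b_n / 2 + 1, i b_n / 2], also when b_n is odd. *)
Definition Nhalf (n i : nat) (w : T) : R :=
  \big[Num.max/0]_(1 <= s < n.+1 |
      ((i - 1) * b n + 2 <= 2 * s <= i * b n)%N) U s w.

(* 1 is a neutral value for this minimum, as N'_{ni} <= 1. *)
Definition A5 : Prop :=
  forall c : R, 0 < c < 1 ->
    Pr [set w | \big[Num.min/1]_(1 <= i < (2 * k n).+1) Nhalf n i w <= c]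
      @[n --> within S \oo] --> (0 : R).

Definition A7 (theta : R) : Prop :=
  (fun n => fine 'E_P[Z (b n)] - theta^-1 : R) =o_ (within S \oo)
    (fun n => (Num.sqrt (k n)%:R)^-1 : R).

Definition condP : Prop :=
  forall x : R, 0 < x ->
    limf_esup (fun n => (cPr [set w | 1 - x / n%:R < N m (b n) w]
                             [set w | 1 - x / n%:R <= U 1 w])%:E)
              (within S \oo)
      @[m --> \oo] --> (0 : \bar R)%E.

Definition Fhat (n : nat) (w : T) (x : R) : R :=
  n%:R^-1 * \sum_(1 <= s < n.+1) (X s w <= x)%R%:R.

Definition Nhat_dj (n i : nat) (w : T) : R :=
  Fhat n w (maxX ((i - 1) * b n + 1) (b n) w).

Definition Zhat_dj (n i : nat) (w : T) : R :=
  (b n)%:R * (1 - Nhat_dj n i w).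

Definition Yhat_dj (n i : nat) (w : T) : R :=
  - (b n)%:R * ln (Nhat_dj n i w).

Definition thetaB_dj (n : nat) (w : T) : R :=
  ((k n)%:R^-1 * \sum_(1 <= i < (k n).+1) Zhat_dj n i w)^-1.

Definition thetaN_dj (n : nat) (w : T) : R :=
  ((k n)%:R^-1 * \sum_(1 <= i < (k n).+1) Yhat_dj n i w)^-1.

Definition Nhat_sl (n t : nat) (w : T) : R := Fhat n w (maxX t (b n) w).

Definition Zhat_sl (n t : nat) (w : T) : R := (b n)%:R * (1 - Nhat_sl n t w).

Definition Yhat_sl (n t : nat) (w : T) : R := - (b n)%:R * ln (Nhat_sl n t w).

Definition thetaB_sl (n : nat) (w : T) : R :=
  ((n - b n + 1)%N%:R^-1 *
   \sum_(1 <= t < (n - b n + 1).+1) Zhat_sl n t w)^-1.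

Definition thetaN_sl (n : nat) (w : T) : R :=
  ((n - b n + 1)%N%:R^-1 *
   \sum_(1 <= t < (n - b n + 1).+1) Yhat_sl n t w)^-1.

Definition is_oP1 (W : nat -> T -> R) : Prop :=
  forall eps : R, 0 < eps ->
    Pr [set w | eps < `|W n w|] @[n --> within S \oo] --> (0 : R).

End Blocks.
End Process.

(* Main.v *)
From HB Require Import structures.
Require Import Defs.
From mathcomp Require Import all_boot all_order all_algebra.
From mathcomp Require Import all_classical all_reals all_analysis.
From mathcomp Require Import measurable_realfun lra ring zify.

Set Implicit Arguments.
Unset Strict Implicit.
Unset Printing Implicit Defensive.

Import Order.TTheory GRing.Theory Num.Theory.
Import numFieldNormedType.Exports.

Local Open Scope classical_set_scope.
Local Open Scope ring_scope.

(* Since - ln (1 - z) - z is of order z^2, the difference of the two inverse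
   means is at most a constant times b^-1 (mean of Zhat^2) / (mean of Zhat)^2,
   and sqrt k / b -> 0; it remains to bound the mean of Zhat^2 from above and the
   mean of Zhat from below, in probability.  Everything is read off the counts
   cnt u = #{s <= n : U_s > u}: Zhat_t is at most cnt u / k if the block of t
   contains some U_s > u, and at least cnt u / k otherwise.
   - Upper bound: classify the blocks by the dyadic size 2^j of b (1 - max U).
     By (A6) the proportion of blocks of size 2^j is O(2^-(2 + delta) j); by (A4)
     and Chebyshev, cnt (1 - 2^j / b) <= k O((2 rho)^j) simultaneously for all j,
     where rho > 1 is as close to 1 as needed, so that the series of the second
     moments converges.
   - Lower bound: at least half of the blocks do not exceed 1 - x / b if x is
     small, and cnt (1 - x / b) >= c k: the extremal index bounds from below the
     probability that a block exceeds 1 - x / b, and the number of the blocks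
     that do concentrates by mixing. *)

(** * Deterministic comparison of the two inverse means *)

Section Deterministic.
Context {R : realType}.

(** The upper bound is [ln v <= v - 1] at [v = (1 - z)^-1], because [v - 1 = z + v z^2] and [v <= 2]
    for [z <= 1/2]. *)
Lemma ln1B_bound (z : R) : 0 <= z <= 1 / 2 -> z <= - ln (1 - z) <= z + 2 * z ^+ 2.
Proof.
move=> /andP[z0 z1]; have p0 : 0 < 1 - z by lra.
apply/andP; split.
  by rewrite lerNr; apply: le_ln1Dx; lra.
have v0 : 0 < (1 - z)^-1 by rewrite invr_gt0.
rewrite -lnV ?posrE//.
have -> : (1 - z)^-1 = 1 + ((1 - z)^-1 - 1) by ring.
apply: le_trans (le_ln1Dx _) _; first lra.
have -> : (1 - z)^-1 - 1 = z + (1 - z)^-1 * z ^+ 2 by field; lra.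
rewrite lerD2l ler_wpM2r ?sqr_ge0//.
by rewrite -[leLHS]mul1r ler_pdivrMr//; lra.
Qed.

(** Let [a] and [y] be the means of the [z t] and of the logarithmic terms. Termwise, [a <= y] and
    [y - a] is at most [2 / B] times the mean of [z^2]; then [a^-1 - y^-1 = (y - a) / (a y)] with
    [a y >= c^2]. *)
Lemma inv_mean_log_diff (I : eqType) (L : seq I) (z : I -> R) (B c : R) :
  0 < B -> 0 < c -> {in L, forall t, 0 <= z t <= B / 2} ->
  c <= (size L)%:R^-1 * (\sum_(t <- L) z t) ->
  `| ((size L)%:R^-1 * (\sum_(t <- L) z t))^-1 -
     ((size L)%:R^-1 * (\sum_(t <- L) - B * ln (1 - z t / B)))^-1 |
  <= 2 / B / c ^+ 2 * ((size L)%:R^-1 * \sum_(t <- L) z t ^+ 2).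
Proof.
move=> B0 c0 hz hc.
set m := (size L)%:R^-1 in hc *; have m0 : 0 <= m by rewrite invr_ge0.
have hb : {in L, forall t, z t <= - B * ln (1 - z t / B) <= z t + 2 / B * z t ^+ 2}.
  move=> t /hz /andP[z0 z1]; have : 0 <= z t / B <= 1 / 2.
    by rewrite divr_ge0 ?(ltW B0)//= ler_pdivrMr//; lra.
  move=> /ln1B_bound /andP[h1 h2].
  have -> : - B * ln (1 - z t / B) = B * - ln (1 - z t / B) by ring.
  have e1 : z t = B * (z t / B) by field; lra.
  apply/andP; split; first by rewrite {1}e1 ler_pM2l.
  have -> : z t + 2 / B * z t ^+ 2 = B * (z t / B + 2 * (z t / B) ^+ 2).
    by field; lra.
  by rewrite ler_pM2l.
set a := m * _ in hc *; set y := m * (\sum_(t <- L) - B * _).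
set q := m * (\sum_(t <- L) z t ^+ 2).
have ay : a <= y.
  by apply: ler_wpM2l => //; rewrite !big_seq; apply: ler_sum => t /hb /andP[].
have yq : y - a <= 2 / B * q.
  rewrite /y /a -mulrBr -sumrB /q mulrCA [X in _ <= m * X]mulr_sumr.
  apply: ler_wpM2l => //; rewrite !big_seq; apply: ler_sum => t /hb /andP[_ h].
  by rewrite lerBlDl.
clearbody a y.
have a0 : 0 < a by lra.
have y0 : 0 < y by lra.
have -> : a^-1 - y^-1 = (y - a) / (a * y) by field; lra.
have d0 : 0 <= (y - a) / (a * y) by apply: divr_ge0; [lra|apply/ltW/mulr_gt0].
rewrite ger0_norm//.
rewrite ler_pdivrMr ?mulr_gt0//; apply: le_trans yq _.
have q0 : 0 <= 2 / B * q.
  rewrite mulr_ge0 ?divr_ge0 ?(ltW B0)// mulr_ge0// sumr_ge0// => t _.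
  exact: sqr_ge0.
have -> : 2 / B / c ^+ 2 * q * (a * y) = (2 / B * q) * (a * y / c ^+ 2).
  by field; lra.
rewrite ler_peMr// ler_pdivlMr ?exprn_gt0// mul1r expr2.
by apply: ler_pM; lra.
Qed.

End Deterministic.

(** * Measurability of finite maxima and minima and of comparison events *)

Lemma measurable_bigmax {d : measure_display} {T : measurableType d} {R : realType}
    (I : Type) (r : seq I) (Q : pred I) (f : T -> R) (h : I -> T -> R) :
  measurable_fun [set: T] f -> (forall i, measurable_fun [set: T] (h i)) ->
  measurable_fun [set: T] (fun w => \big[Num.max/f w]_(i <- r | Q i) h i w).
Proof.
move=> mf mh; elim: r => [|i r IH].
  by under eq_fun do rewrite big_nil.
under eq_fun do rewrite big_cons.
by case: (Q i) => //; exact: measurable_maxr.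
Qed.

Lemma measurable_bigmin {d : measure_display} {T : measurableType d} {R : realType}
    (I : Type) (r : seq I) (f : T -> R) (h : I -> T -> R) :
  measurable_fun [set: T] f -> (forall i, measurable_fun [set: T] (h i)) ->
  measurable_fun [set: T] (fun w => \big[Num.min/f w]_(i <- r) h i w).
Proof.
move=> mf mh; elim: r => [|i r IH].
  by under eq_fun do rewrite big_nil.
under eq_fun do rewrite big_cons.
exact: measurable_minr.
Qed.

Lemma measurable_le_fun {d : measure_display} {T : measurableType d} {R : realType}
    (f g : T -> R) : measurable_fun [set: T] f -> measurable_fun [set: T] g ->
  measurable [set w | f w <= g w].
Proof.
move=> mf mg; rewrite -[X in measurable X]setTI.
rewrite [X in _ `&` X](_ : _ = (fun w => f w <= g w) @^-1` [set true]).
  exact: measurable_fun_ler.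
by apply/seteqP; split.
Qed.

Lemma measurable_lt_fun {d : measure_display} {T : measurableType d} {R : realType}
    (f g : T -> R) : measurable_fun [set: T] f -> measurable_fun [set: T] g ->
  measurable [set w | f w < g w].
Proof.
move=> mf mg; rewrite -[X in measurable X]setTI.
rewrite [X in _ `&` X](_ : _ = (fun w => f w < g w) @^-1` [set true]).
  exact: measurable_fun_ltr.
by apply/seteqP; split.
Qed.

(** * Real-valued probabilities and Markov's inequality for finite combinations of indicators *)

Section Probability.
Context {d : measure_display} {T : measurableType d} {R : realType}.
Variable P : probability T R.

Lemma Pr_ge0 (A : set T) : 0 <= Pr P A.
Proof. exact/fine_ge0/measure_ge0. Qed.

Lemma PrE (A : set T) : measurable A -> (Pr P A)%:E = P A.
Proof. by move=> mA; rewrite /Pr fineK// fin_num_measure. Qed.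

Lemma Pr_le1 (A : set T) : measurable A -> Pr P A <= 1.
Proof. by move=> mA; rewrite -lee_fin PrE// probability_le1. Qed.

Lemma le_Pr (A B : set T) : measurable A -> measurable B -> A `<=` B ->
  Pr P A <= Pr P B.
Proof. by move=> mA mB AB; rewrite -lee_fin !PrE// le_measure ?inE. Qed.

Lemma PrU (A B : set T) : measurable A -> measurable B ->
  Pr P (A `|` B) <= Pr P A + Pr P B.
Proof.
by move=> mA mB; rewrite -lee_fin EFinD !PrE//; [exact: measureU2|exact: measurableU].
Qed.

Lemma PrC (A : set T) : measurable A -> Pr P (~` A) = 1 - Pr P A.
Proof.
move=> mA; apply: EFin_inj; rewrite EFinB !PrE//; last exact: measurableC.
exact: probability_setC.
Qed.

Lemma measurable_indic_comb (I : Type) (r : seq I) (a : I -> R) (A : I -> set T) :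
  (forall i, measurable (A i)) ->
  measurable_fun [set: T] (fun w => \sum_(i <- r) a i * \1_(A i) w).
Proof.
by move=> mA; apply: measurable_sum => i; apply: measurable_funM.
Qed.

Lemma integral_indic_comb (I : Type) (r : seq I) (a : I -> R) (A : I -> set T) :
  (forall i, measurable (A i)) ->
  P.-integrable setT (fun w => (\sum_(i <- r) a i * \1_(A i) w)%:E) /\
  (\int[P]_w (\sum_(i <- r) a i * \1_(A i) w)%:E =
    (\sum_(i <- r) a i * Pr P (A i))%:E)%E.
Proof.
move=> mA; elim: r => [|i r [IH1 IH2]].
  under [in X in X /\ _]eq_fun do rewrite big_nil.
  under eq_integral do rewrite big_nil.
  by rewrite big_nil integral0; split => //; exact: integrable0.
have hi : P.-integrable setT (EFin \o (\1_(A i) : T -> R)).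
  exact: integrable_indic.
have hai : P.-integrable setT (fun w => (a i * \1_(A i) w)%:E).
  have := @integrableZl _ _ _ P setT measurableT (a i) _ hi.
  by apply: eq_integrable => // w _ /=; rewrite EFinM.
under [in X in X /\ _]eq_fun do rewrite big_cons EFinD.
under eq_integral do rewrite big_cons EFinD.
split; first exact: integrableD.
rewrite integralD// IH2 big_cons EFinD; congr (_ + _)%E.
under eq_integral do rewrite EFinM.
rewrite (@integralZl _ _ _ P setT measurableT _ hi) integral_indic// setIT.
by rewrite EFinM PrE.
Qed.

(** The coefficients may be negative; only the whole combination has to be nonnegative. An expanded
    square of a centred count is thus covered in the same way as a count. *)
Lemma markov_indic_comb (I : Type) (r : seq I) (a : I -> R) (A : I -> set T) (K : R) :
  (forall i, measurable (A i)) -> 0 < K ->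
  (forall w, 0 <= \sum_(i <- r) a i * \1_(A i) w) ->
  Pr P [set w | K <= \sum_(i <- r) a i * \1_(A i) w] <=
    (\sum_(i <- r) a i * Pr P (A i)) / K.
Proof.
move=> mA K0 f0; have [_ h] := integral_indic_comb r a mA.
have mf := measurable_indic_comb r a mA.
set B := [set w | _]; have mB : measurable B by exact: measurable_le_fun.
rewrite ler_pdivlMr// -lee_fin -h mulrC EFinM PrE//.
rewrite -(setIT B) -integral_indic// -ge0_integralZl//; last 2 first.
- by apply/measurable_EFinP.
- by rewrite lee_fin ltW.
apply: ge0_le_integral => //.
- by move=> w _; rewrite -EFinM lee_fin mulr_ge0 ?(ltW K0).
- under eq_fun do rewrite -EFinM.
  by apply/measurable_EFinP; apply: measurable_funM.
- by apply/measurable_EFinP.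
- move=> w _; rewrite -EFinM lee_fin indicE.
  have [|_] := boolP (w \in B); last by rewrite mulr0.
  by rewrite inE mulr1.
Qed.

End Probability.

(** * Exceedances of a level by a block and in the whole sample *)

Section Exceedances.
Context {d : measure_display} {T : measurableType d} {R : realType}.
Variables (P : probability T R) (X : nat -> {RV P >-> R}).

Definition exc (t m : nat) (u : R) : set T :=
  [set w | exists2 i, (t <= i < t + m)%N & u < U X i w].

Definition cnt (n : nat) (u : R) (w : T) : R :=
  \sum_(1 <= s < n.+1) (u < U X s w)%R%:R.

Lemma le_exc t m (u v : R) : u <= v -> exc t m v `<=` exc t m u.
Proof. by move=> uv w [i hi h]; exists i => //; exact: le_lt_trans h. Qed.

Lemma cnt_ge0 n u w : 0 <= cnt n u w.
Proof. exact: sumr_ge0. Qed.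

Lemma cdfE (s : nat) x : cdf (X s) x = P [set w | X s w <= x].
Proof. by []. Qed.

Lemma F_nondecreasing : {homo F X : x y / x <= y}.
Proof.
move=> x y xy; apply: fine_le; rewrite ?fin_num_measure//.
exact: cdf_nondecreasing.
Qed.

Lemma F_ge0 x : 0 <= F X x.
Proof. exact/fine_ge0/measure_ge0. Qed.

Hypothesis Fcont : continuous (F X).

Lemma measurable_U s : measurable_fun [set: T] (U X s).
Proof. by apply: measurableT_comp => //; exact: continuous_measurable_fun. Qed.

Lemma measurable_ltU s (u : R) : measurable [set w | u < U X s w].
Proof. by apply: measurable_lt_fun => //; exact: measurable_U. Qed.

Lemma measurable_exc t m u : measurable (exc t m u).
Proof.
rewrite (_ : exc t m u = \bigcup_(i in [set i | (t <= i < t + m)%N])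
  [set w | u < U X i w]); first by apply: bigcup_measurable => i _; exact: measurable_ltU.
by apply/seteqP; split => w [i]; exists i.
Qed.

Lemma cntE n u : cnt n u =
  (fun w => \sum_(1 <= s < n.+1) 1 * \1_[set w | u < U X s w] w).
Proof.
apply/funext => w; apply: eq_bigr => s _; rewrite mul1r indicE.
by congr (nat_of_bool _)%:R; apply/idP/idP; rewrite inE.
Qed.

Lemma measurable_cnt n u : measurable_fun [set: T] (cnt n u).
Proof. by rewrite cntE; apply: measurable_indic_comb => s; exact: measurable_ltU. Qed.

Hypothesis Xstat : stationary X.

Lemma Pr_exc t m u : (1 <= t)%N -> Pr P (exc t m u) = Pr P (exc 1 m u).
Proof.
(* The event is the preimage of one fixed set of tuples under [window], whose first entry has index
   [h.+1]; stationarity then removes the shift. *)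
have H h : exc h.+1 m u =
    window X m h @^-1` [set v | exists i : 'I_m, u < F X (tnth v i)].
  apply/seteqP; split => w /=.
    move=> [i /andP[hi im] uU]; have ilt : (i - h.+1 < m)%N by lia.
    exists (Ordinal ilt); rewrite tnth_mktuple /=.
    by rewrite (_ : (h + (i - h.+1)).+1 = i)//; lia.
  move=> [i]; rewrite tnth_mktuple => uU; exists (h + i).+1 => //.
  by have := ltn_ord i; lia.
have mA : measurable [set v : m.-tuple R | exists i : 'I_m, u < F X (tnth v i)].
  rewrite (_ : [set v | _] = \bigcup_(i in [set: 'I_m])
      ((@tnth _ R ^~ i) @^-1` [set x | u < F X x])).
    apply: fin_bigcup_measurable; first exact: finite_finset.
    move=> i _; rewrite -[X in measurable X]setTI; apply: measurable_tnth => //.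
    by apply: measurable_lt_fun => //; exact: continuous_measurable_fun.
  by apply/seteqP; split => v; [move=> [i]|move=> [i _]]; exists i.
by case: t => // h _; rewrite /Pr !H Xstat.
Qed.

(** One half of the probability integral transform: continuity gives [x] with [F x = u], and [U > u]
    forces [X > x] by monotonicity of [F]. *)
Lemma Pr_ltU s (u : R) : (1 <= s)%N -> u < 1 -> Pr P [set w | u < U X s w] <= 1 - u.
Proof.
move=> s1 u1; have [u0|u0] := leP u 0.
  by apply: le_trans (Pr_le1 _ (measurable_ltU s u)) _; lra.
have FE x : (F X x)%:E = cdf (X 1%N) x by rewrite fineK// fin_num_measure.
(* The limits 0 and 1 of the cdf provide values of [F] on both sides of [u], as the intermediate
   value theorem requires. *)
have [a Fa] : exists a, F X a < u.
  have /= [M [_ HM]] : (cdf (X 1%N) x @[x --> -oo]) [set y | (y < u%:E)%E].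
    by apply: cvg_cdfNy0; apply: open_ereal_lt'; rewrite lte_fin.
  by exists (M - 1); rewrite -lte_fin FE; apply: HM; lra.
have [c Fc] : exists c, u < F X c.
  have /= [M [_ HM]] : (cdf (X 1%N) x @[x --> +oo]) [set y | (u%:E < y)%E].
    by apply: cvg_cdfy1; apply: open_ereal_gt'; rewrite lte_fin.
  by exists (M + 1); rewrite -lte_fin FE; apply: HM; lra.
have [x _ Fx] : exists2 x, x \in `[a, c] & F X x = u.
  have ac : a <= c.
    by rewrite leNgt; apply/negP => /ltW /F_nondecreasing; lra.
  apply: IVT => //; first exact: continuous_subspaceT.
  by rewrite ge_min le_max (ltW Fa) (ltW Fc) orbT.
have mle : measurable [set w | X s w <= x] by exact: measurable_le_fun.
apply: (@le_trans _ _ (Pr P (~` [set w | X s w <= x]))).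
  apply: le_Pr; [exact: measurable_ltU|exact: measurableC|].
  move=> w /= uU; apply/negP; rewrite -ltNge ltNge; apply/negP => /F_nondecreasing.
  by rewrite Fx leNgt uU.
rewrite PrC// lerD2l lerN2 -{1}Fx /F cdfE.
(* [F] is the cdf of [X 1]; stationarity of windows of length one transfers it to the index [s]. *)
case: s s1 mle => // h _ mle.
have := @Xstat 1 h [set v | tnth v ord0 <= x].
have H i : window X 1 i @^-1` [set v | tnth v ord0 <= x] = [set w | X i.+1 w <= x].
  by apply/seteqP; split => w /=; rewrite tnth_mktuple addn0.
rewrite !H /Pr => ->//.
rewrite -[X in measurable X]setTI.
rewrite [X in _ `&` X](_ : _ = (@tnth 1 R ^~ ord0) @^-1` `]-oo, x]).
  by apply: measurable_tnth.
by apply/seteqP; split => v /=; rewrite in_itv.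
Qed.

Lemma Pr_exc_le t m (u : R) : (1 <= t)%N -> u < 1 -> Pr P (exc t m u) <= m%:R * (1 - u).
Proof.
move=> t1 u1; elim: m => [|m IH].
  rewrite mul0r /Pr (_ : exc _ _ _ = set0) ?measure0//.
  by apply/seteqP; split => // w [i]; lia.
have -> : exc t m.+1 u = exc t m u `|` [set w | u < U X (t + m) w].
  apply/seteqP; split => w.
    move=> [i hi h]; have [im|im] := ltnP i (t + m)%N; [left; exists i => //|right].
      by lia.
    by rewrite /= (_ : (t + m)%N = i)//; lia.
  move=> [[i hi h]|h]; [exists i => //; lia|exists (t + m)%N => //; lia].
apply: le_trans (PrU _ (measurable_exc _ _ _) (measurable_ltU _ _)) _.
rewrite -natr1 mulrDl mul1r lerD// Pr_ltU//; lia.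
Qed.

Lemma Pr_cnt_ge n (u K : R) : u < 1 -> 0 < K ->
  Pr P [set w | K <= cnt n u w] <= n%:R * (1 - u) / K.
Proof.
move=> u1 K0; rewrite cntE.
apply: le_trans (markov_indic_comb _ _ _ _) _ => //.
- by move=> s; exact: measurable_ltU.
- by move=> w; apply: sumr_ge0.
rewrite ler_pM2r ?invr_gt0//.
have -> : n%:R * (1 - u) = \sum_(1 <= s < n.+1) (1 - u).
  by rewrite sumr_const_nat subn1 mulr_natl.
rewrite !big_nat; apply: ler_sum => s /andP[s1 _].
by rewrite mul1r; exact: Pr_ltU.
Qed.

End Exceedances.

(** Chebyshev's inequality: the pairs of distinct events add at most [m^2 g] to the variance of the
    count and the diagonal at most [m]; the result is divided by [(m p / 2)^2]. *)
Lemma chebyshev_events {d : measure_display} {T : measurableType d} {R : realType}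
    (P : probability T R) (m : nat) (A : nat -> set T) (p g : R) :
  (forall i, measurable (A i)) -> (forall i, Pr P (A i) = p) ->
  (forall i j, i != j -> Pr P (A i `&` A j) <= p ^+ 2 + g) ->
  0 <= g -> 0 < p -> (0 < m)%N ->
  Pr P [set w | \sum_(0 <= i < m) \1_(A i) w <= m%:R * p / 2] <=
    (m%:R^-1 + g) * (4 / p ^+ 2).
Proof.
move=> mA pA cA g0 p0 m0; have m0' : 0 < m%:R :> R by rewrite ltr0n.
(* The index type spells out the expansion of [(S - m p)^2]: pairs for [S^2], [Some i] for the cross
   term, [None] for the constant. *)
pose r : seq ((nat * nat) + option nat) :=
  [seq inl (i, j) | i <- index_iota 0 m, j <- index_iota 0 m] ++
  ([seq inr (Some i) | i <- index_iota 0 m] ++ [:: inr None]).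
pose a (x : (nat * nat) + option nat) : R := match x with
  | inl _ => 1 | inr (Some _) => - (2 * m%:R * p) | inr None => (m%:R * p) ^+ 2 end.
pose B (x : (nat * nat) + option nat) := match x with
  | inl (i, j) => A i `&` A j | inr (Some i) => A i | inr None => setT end.
have mB x : measurable (B x) by move: x => [[i j]|[i|]] /=; first exact: measurableI.
pose S w : R := \sum_(0 <= i < m) \1_(A i) w.
have sq w : \sum_(x <- r) a x * \1_(B x) w = (S w - m%:R * p) ^+ 2.
  rewrite /r !big_cat /= big_allpairs_dep big_map big_seq1 /= indicT mulr1.
  rewrite -mulr_sumr -/(S w).
  have -> : \sum_(0 <= i < m) \sum_(0 <= j < m) 1 * \1_(A i `&` A j) w = S w * S w.
    rewrite /S mulr_suml; apply: eq_bigr => i _; rewrite mulr_sumr.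
    by apply: eq_bigr => j _; rewrite mul1r indicI.
  by ring.
have K0 : 0 < (m%:R * p / 2) ^+ 2 by rewrite exprn_gt0 ?divr_gt0 ?mulr_gt0.
have f0 w : 0 <= \sum_(x <- r) a x * \1_(B x) w by rewrite sq sqr_ge0.
have := markov_indic_comb P mB K0 f0.
set V := \sum_(x <- r) _ => hP.
have hV : V <= m%:R + m%:R ^+ 2 * g.
  rewrite /V /r !big_cat /= big_allpairs_dep big_map big_seq1 /= -mulr_sumr.
  have -> : \sum_(0 <= i < m) Pr P (A i) = m%:R * p.
    by under eq_bigr do rewrite pA; rewrite sumr_const_nat subn0 mulr_natl.
  have -> : Pr P [set: T] = 1 by rewrite /Pr probability_setT.
  suff : \sum_(0 <= i < m) \sum_(0 <= j < m) 1 * Pr P (A i `&` A j) <=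
      m%:R + m%:R ^+ 2 * (p ^+ 2 + g) by lra.
  have -> : m%:R + m%:R ^+ 2 * (p ^+ 2 + g) =
      \sum_(0 <= i < m) (1 + m%:R * (p ^+ 2 + g)).
    by rewrite sumr_const_nat subn0 mulr_natl; ring.
  rewrite !big_nat; apply: ler_sum => i hi.
  (* A row bound: 1 for the diagonal entry, plus [p^2 + g] for every entry. *)
  have -> : 1 + m%:R * (p ^+ 2 + g) =
      \sum_(0 <= j < m) ((j == i)%:R + (p ^+ 2 + g)).
    rewrite big_split/= sumr_const_nat subn0 mulr_natl; congr (_ + _).
    rewrite (bigD1_seq i)/= ?iota_uniq// ?mem_index_iota// eqxx big1 ?addr0//.
    by move=> j /negPf ->.
  apply: ler_sum => j _; rewrite mul1r; have [->|ji] := eqVneq j i.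
    rewrite mulr1n.
    have := Pr_le1 P (measurableI _ _ (mA i) (mA i)).
    have := sqr_ge0 p; lra.
  by rewrite add0r; apply: cA; rewrite eq_sym.
apply: le_trans (le_trans hP _).
  apply: le_Pr.
  - by apply: measurable_le_fun => //; apply: measurable_sum => i; exact: measurable_indic.
  - by apply: measurable_le_fun => //; exact: measurable_indic_comb.
  move=> w /= hw; rewrite sq -/(S w) in hw *.
  have : m%:R * p / 2 <= m%:R * p - S w by lra.
  have mp0 : 0 < m%:R * p by rewrite mulr_gt0.
  move=> h; rewrite -[X in _ <= X]sqrrN opprB; rewrite lerXn2r// ?nnegrE; lra.
apply: (@le_trans _ _ ((m%:R + m%:R ^+ 2 * g) / (m%:R * p / 2) ^+ 2)).
  by rewrite ler_pM2r ?invr_gt0.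
rewrite le_eqVlt; apply/orP; left; apply/eqP.
by field; rewrite !gt_eqF.
Qed.

(** * Consequences of the variance, moment, extremal index and mixing assumptions *)

Section Inputs.
Context {d : measure_display} {T : measurableType d} {R : realType}.
Variables (P : probability T R) (X : nat -> {RV P >-> R}).
Hypotheses (Fcont : continuous (F X)) (Xstat : stationary X).

Lemma Pr_cnt_chebyshev n (u e V : R) : u < 1 -> 0 < e ->
  ('V_P[cnt X n u] <= V%:E)%E ->
  Pr P [set w | n%:R * (1 - u) + e <= cnt X n u w] <= V / e ^+ 2.
Proof.
move=> u1 e0 hV; have mc := measurable_cnt Fcont n u.
pose c : {mfun T >-> R} := HB.pack (cnt X n u) (isMeasurableFun.Build _ _ _ _ _ mc).
have := @chebyshev _ _ _ P c _ e0.
have EE : fine 'E_P[c] <= n%:R * (1 - u).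
  rewrite unlock /= cntE.
  have [_ ->] := integral_indic_comb P (index_iota 1 n.+1) (fun=> 1)
    (fun s => measurable_ltU Fcont s u).
  have -> : n%:R * (1 - u) = \sum_(1 <= s < n.+1) (1 - u).
    by rewrite sumr_const_nat subn1 mulr_natl.
  rewrite /= !big_nat; apply: ler_sum => s /andP[s1 _].
  by rewrite mul1r; exact: Pr_ltU.
move=> H; rewrite -lee_fin PrE; last exact: measurable_le_fun.
apply: le_trans (le_trans H _); last first.
  by rewrite mulrC EFinM lee_pmul2l// lte_fin invr_gt0 exprn_gt0.
apply: le_measure; rewrite ?inE.
- exact: measurable_le_fun.
- apply: measurable_le_fun => //; apply: measurableT_comp => //.
  by apply: measurable_funB.
- move=> w /= hw; rewrite ler_normr; apply/orP; left; lra.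
Qed.

(** Markov's inequality for the moment of order [2 + delta]: a block without a value above
    [1 - z / m] has [Z >= z]. The constant is uniform in [z] and in all large [m]. *)
Lemma Z_tail delta : A6 X delta -> 0 < delta -> exists2 C : R, 0 < C &
  \forall m \near \oo, forall z, 0 < z ->
    Pr P (~` exc X 1 m (1 - z / m%:R)) <= C / z `^ (2 + delta).
Proof.
(* The limit superior is an infimum of suprema over neighbourhoods of infinity; as it is finite, the
   moments are bounded on one of them, [V]. *)
move=> h6 d0; have [y [V V1 <-]] := ereal_inf_lt h6.
set y0 := ereal_sup _ => hy.
have [C C0 hC] : exists2 C : R, 0 < C & (y0 <= C%:E)%E.
  case: y0 hy => [r _|//|_]; last by exists 1; rewrite ?leNye.
  by exists (`|r| + 1); [have := normr_ge0 r; lra|rewrite lee_fin; have := ler_norm r; lra].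
exists C => //.
near=> m => z z0.
have m0 : (0 < m)%N by near: m; exact: nbhs_infty_gt.
have m0' : 0 < m%:R :> R by rewrite ltr0n.
rewrite ler_pdivlMr ?powR_gt0//.
have mE := measurable_exc Fcont 1 m (1 - z / m%:R).
have mZ : measurable_fun [set: T] (Z X m).
  apply: measurable_funM => //; apply: measurable_funB => //.
  by apply: measurable_bigmax => // i; exact: measurable_U.
have mZp : measurable_fun [set: T] (fun w => Z X m w `^ (2 + delta)).
  exact: (measurableT_comp (measurable_powR (2 + delta)) mZ).
rewrite -lee_fin; apply: le_trans hC.
apply: le_trans (_ : 'E_P[fun w => (Z X m w `^ (2 + delta))%R] <= _)%E; last first.
  apply: ereal_sup_ubound; exists m => //=.
  by near: m.
rewrite mulrC EFinM PrE; last exact: measurableC.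
rewrite -(setIT (~` _)) -integral_indic//; last exact: measurableC.
rewrite -ge0_integralZl//; last 2 first.
- by apply/measurable_EFinP; apply: measurable_indic; exact: measurableC.
- by rewrite lee_fin powR_ge0.
rewrite unlock; apply: ge0_le_integral => //.
- by move=> w _; rewrite -EFinM lee_fin mulr_ge0 ?powR_ge0.
- under eq_fun do rewrite -EFinM.
  apply/measurable_EFinP; apply: measurable_funM => //.
  by apply: measurable_indic; exact: measurableC.
- by apply/measurable_EFinP.
move=> w _; rewrite -EFinM lee_fin indicE.
have [|_] := boolP (w \in ~` _); last by rewrite mulr0 powR_ge0.
rewrite inE mulr1 => nE.
have le i : (1 <= i < 1 + m)%N -> U X i w <= 1 - z / m%:R.
  by move=> hi; rewrite leNgt; apply/negP => hU; apply: nE; exists i.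
(* The maximum in [N] starts from 0, so the level has to be nonnegative; it dominates [U 1], which
   is. *)
have z1 : 0 <= 1 - z / m%:R.
  by apply: le_trans (le 1%N _); [exact: F_ge0|lia].
have N1 : N X 1 m w <= 1 - z / m%:R.
  by rewrite /N big_nat; apply: bigmax_le => // i hi; apply: le; lia.
have zZ : z <= Z X m w.
  rewrite /Z -ler_pdivrMl//; lra.
by apply: ge0_ler_powR; rewrite ?nnegrE; lra.
Unshelve. all: by end_near. Qed.

(** The levels [u m] belonging to [tau = x / 2] eventually satisfy [F (u m) > 1 - x / m], so that a
    maximum above [u m] is an exceedance of [1 - x / m]. Its probability tends to
    [1 - exp (- theta x / 2) > 0]. *)
Lemma exc_extremal_index theta x : extremal_index X theta -> 0 < theta -> 0 < x ->
  exists2 p0 : R, 0 < p0 &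
  \forall m \near \oo, p0 <= Pr P (exc X 1 m (1 - x / m%:R)).
Proof.
move=> hE t0 x0; have [u [hu1 hu2]] := hE (x / 2) (divr_gt0 x0 (ltr0Sn _ 1)).
set e := expR _ in hu2; have e1 : e < 1.
  by rewrite /e -expR0 ltr_expR oppr_lt0 mulr_gt0// divr_gt0.
exists ((1 - e) / 2); first lra.
near=> m.
have m0 : (0 < m)%N by near: m; exact: nbhs_infty_gt.
have m0' : 0 < m%:R :> R by rewrite ltr0n.
have h1 : m%:R * (1 - F X (u m)) < x.
  by near: m; apply: (cvgr_lt (x / 2) hu1); lra.
have h2 : Pr P [set w | maxX X 1 m w <= u m] < (1 + e) / 2.
  by near: m; apply: (cvgr_lt e hu2); lra.
have mM : measurable [set w | maxX X 1 m w <= u m].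
  by apply: measurable_le_fun => //; apply: measurable_bigmax.
have mE := measurable_exc Fcont 1 m (1 - x / m%:R).
suff : Pr P (~` exc X 1 m (1 - x / m%:R)) <= Pr P [set w | maxX X 1 m w <= u m].
  by rewrite PrC//; lra.
apply: le_Pr => //; first exact: measurableC.
move=> w nE /=.
have le i : (1 <= i < 1 + m)%N -> X i w <= u m.
  move=> hi; rewrite leNgt; apply/negP => /ltW /(F_nondecreasing X) uX.
  apply: nE; exists i => //; rewrite /U; apply: lt_le_trans uX.
  by move: h1; rewrite -ltr_pdivlMl//; lra.
rewrite /maxX big_nat; apply: bigmax_le => //; apply: le; lia.
Unshelve. all: by end_near. Qed.

(** The blocks are disjoint, and each one that exceeds [u] contains at least one counted index. *)
Lemma cnt_ge_blocks n m b (u : R) w : (2 * b * m <= n)%N ->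
  \sum_(0 <= i < m) \1_(exc X (2 * b * i + 1) b u) w <= cnt X n u w.
Proof.
move=> le; apply: (@le_trans _ _ (cnt X (2 * b * m) u w)); last first.
  rewrite /cnt [leRHS](big_cat_nat _ (n := (2 * b * m).+1)) ?ltnS//=.
  by rewrite lerDl sumr_ge0.
elim: m {le} => [|m IH]; first by rewrite big_nil cnt_ge0.
rewrite big_nat_recr//= /cnt [leRHS](big_cat_nat _ (n := (2 * b * m).+1))//=; last by lia.
rewrite lerD//; rewrite indicE; have [|_] := boolP (w \in _); last by rewrite sumr_ge0.
rewrite inE => -[i hi uU].
rewrite (bigD1_seq i)/= ?iota_uniq// ?mem_index_iota; last by lia.
by rewrite uU lerDl sumr_ge0.
Qed.

(** The generators see [U] only after values up to [1 - eps] are replaced by 0. For [u >= 0] and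
    [u >= 1 - eps] this replacement does not change the event [U > u]. *)
Lemma tail_sigma_exc eps I t m (u : R) : 1 - eps <= u -> 0 <= u ->
  (forall i, (t <= i < t + m)%N -> I i) -> tail_sigma X eps I (exc X t m u).
Proof.
move=> eu u0 HI.
rewrite (_ : exc X t m u = \bigcup_i
    (if (t <= i < t + m)%N then [set w | u < U X i w] else set0)); last first.
  apply/seteqP; split => w [i].
    by move=> hi h; exists i => //=; rewrite hi.
  by move=> _ /=; case: ifP => // hi h; exists i.
apply: sigma_algebra_bigcup => i; case: ifP => hi; last exact: sigma_algebra0.
apply: sub_sigma_algebra; exists i; first exact: HI.
exists `]u, +oo[%classic; first exact: measurable_itv.
rewrite setTI; apply/seteqP; split => w /=; rewrite in_itv/= andbT.
  case: (ltP (1 - eps) (U X i w)) => /= h; rewrite ?mulr1// mulr0.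
  by rewrite ltNge u0.
by move=> h; rewrite (le_lt_trans eu h) mulr1.
Qed.

Lemma tail_sigma_measurable eps I (A : set T) : tail_sigma X eps I A -> measurable A.
Proof.
apply: smallest_sub; first exact: sigma_algebra_measurable.
move=> B [i _ [Y mY <-]].
apply: (measurable_funM (measurable_U Fcont i) _) => //.
rewrite (_ : (fun w => _) = \1_[set w | 1 - eps < U X i w]).
  by apply: measurable_indic; exact: measurable_ltU.
apply/funext => w; rewrite indicE; congr (nat_of_bool _)%:R.
by apply/idP/idP; rewrite inE.
Qed.

(** The real [sup] dominates its members only for a set bounded above; this bound serves both
    suprema in [alpha_eps]. *)
Lemma mixing_gap_le1 (A B : set T) : measurable A -> measurable B ->
  mixing_gap P A B <= 1.
Proof.
move=> mA mB; have mAB := measurableI _ _ mA mB.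
have [[a0 b0] c0] := (Pr_ge0 P A, Pr_ge0 P B, Pr_ge0 P (A `&` B)).
have [[a1 b1] c1] := (Pr_le1 P mA, Pr_le1 P mB, Pr_le1 P mAB).
have q1 : Pr P A * Pr P B <= 1 by rewrite -[1]mulr1 ler_pM.
have q0 : 0 <= Pr P A * Pr P B by rewrite mulr_ge0.
by rewrite /mixing_gap ler_norml; apply/andP; split; lra.
Qed.

Lemma mixing_gap_alpha eps k l (A B : set T) : (1 <= k)%N ->
  tail_sigma X eps [set s | (1 <= s <= k)%N] A ->
  tail_sigma X eps [set s | (k + l <= s)%N] B ->
  mixing_gap P A B <= alpha_eps X eps l.
Proof.
move=> k1 hA hB.
have ub k' : ubound [set r | exists A B, [/\ tail_sigma X eps [set s | (1 <= s <= k')%N] A,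
    tail_sigma X eps [set s | (k' + l <= s)%N] B & r = mixing_gap P A B]] 1.
  move=> r [A' [B' [/tail_sigma_measurable mA /tail_sigma_measurable mB ->]]].
  exact: mixing_gap_le1.
apply: (@le_trans _ _ (mixing_alpha P (tail_sigma X eps [set s | (1 <= s <= k)%N])
                     (tail_sigma X eps [set s | (k + l <= s)%N]))).
  by apply: ub_le_sup; [exists 1; exact: ub|exists A, B].
apply: ub_le_sup; last by exists k.
exists 1 => r [k' [_ ->]]; apply: ge_sup; last exact: ub.
exists (mixing_gap P set0 set0), set0, set0; split => //; exact: sigma_algebra0.
Qed.

Lemma Pr_excI_le eps l m t1 t2 (u : R) : (1 <= t1)%N -> (0 < m)%N ->
  (t1 + m + l <= t2.+1)%N -> 1 - eps <= u -> 0 <= u ->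
  Pr P (exc X t1 m u `&` exc X t2 m u) <=
    Pr P (exc X t1 m u) * Pr P (exc X t2 m u) + alpha_eps X eps l.
Proof.
(* The past ends at [t1 + m - 1], the last index of the first block, and the second block starts at
   least [l] later. *)
move=> h1 hm ht eu u0; have k1 : (1 <= t1 + m - 1)%N by lia.
have i1 i : (t1 <= i < t1 + m)%N -> (1 <= i <= t1 + m - 1)%N by lia.
have i2 i : (t2 <= i < t2 + m)%N -> (t1 + m - 1 + l <= i)%N by lia.
have s1 := tail_sigma_exc (I := [set s | (1 <= s <= t1 + m - 1)%N]) eu u0 i1.
have s2 := tail_sigma_exc (I := [set s | (t1 + m - 1 + l <= s)%N]) eu u0 i2.
have := mixing_gap_alpha k1 s1 s2; rewrite /mixing_gap.
set a := Pr P (_ `&` _); set c := Pr P _ * _.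
by move=> h; have := ler_norm (a - c); lra.
Qed.

End Inputs.

(** * Sample-path bounds on the block statistics, and their measurability *)

Section BlockMeans.
Context {d : measure_display} {T : measurableType d} {R : realType}.
Variables (P : probability T R) (X : nat -> {RV P >-> R}).
Variables (b k : nat -> nat).

(** Because [n = b k], the factor [b / n] is [1 / k], and [k Zhat] is the number of observations
    above the block maximum. *)
Lemma Zhat_slE n t w : n = (b n * k n)%N -> (0 < n)%N ->
  Zhat_sl X b n t w =
  (k n)%:R^-1 * \sum_(1 <= s < n.+1) (maxX X t (b n) w < X s w)%R%:R.
Proof.
move=> nbk n0; rewrite /Zhat_sl /Nhat_sl /Fhat; set M := maxX _ _ _ _.
have b0 : (b n)%:R != 0 :> R by rewrite pnatr_eq0; lia.
have k0 : (k n)%:R != 0 :> R by rewrite pnatr_eq0; lia.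
have nE : n%:R = (b n)%:R * (k n)%:R :> R by rewrite -natrM -nbk.
have : \sum_(1 <= s < n.+1) (X s w <= M)%R%:R =
    n%:R - \sum_(1 <= s < n.+1) (M < X s w)%R%:R :> R.
  apply/eqP; rewrite eq_sym subr_eq -big_split/=; apply/eqP.
  transitivity (\sum_(1 <= s < n.+1) (1 : R)).
    by rewrite sumr_const_nat subn1.
  by apply: eq_bigr => s _; rewrite ltNge; case: (X s w <= M) => /=; ring.
by move=> ->; rewrite nE; field; rewrite b0 k0.
Qed.

Lemma Zhat_sl_ge0 n t w : n = (b n * k n)%N -> (0 < n)%N -> 0 <= Zhat_sl X b n t w.
Proof.
by move=> nbk n0; rewrite Zhat_slE// mulr_ge0 ?sumr_ge0// invr_ge0.
Qed.

(** [F] may have flat pieces. An observation above the block maximum has [U] at least that of every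
    member of the block, hence above [u]. In the converse bound [cnt_le_Zhat_sl], a strict
    inequality between values of [U] gives a strict one between values of [X]. *)
Lemma Zhat_sl_le_cnt n t u w : n = (b n * k n)%N -> (0 < n)%N ->
  exc X t (b n) u w -> Zhat_sl X b n t w <= (k n)%:R^-1 * cnt X n u w.
Proof.
move=> nbk n0 [i hi uU]; rewrite Zhat_slE// ler_wpM2l ?invr_ge0//.
apply: ler_sum => s _; have [|//] := boolP (_ < X s w).
have iM : X i w <= maxX X t (b n) w.
  by apply: (@bigmax_sup_seq _ _ _ _ _ i) => //; rewrite mem_index_iota.
move=> Ms; suff -> : u < U X s w by [].
by apply: lt_le_trans uU _; apply: F_nondecreasing; lra.
Qed.

Lemma cnt_le_Zhat_sl n t u w : n = (b n * k n)%N -> (0 < n)%N ->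
  ~ exc X t (b n) u w -> (k n)%:R^-1 * cnt X n u w <= Zhat_sl X b n t w.
Proof.
move=> nbk n0 nE; rewrite Zhat_slE// ler_wpM2l ?invr_ge0//.
apply: ler_sum => s _; have [us|//] := boolP (u < U X s w).
suff -> : maxX X t (b n) w < X s w by [].
have lt i : (t <= i < t + b n)%N -> X i w < X s w.
  move=> hi; rewrite ltNge; apply/negP => /(F_nondecreasing X) si.
  by apply: nE; exists i => //; exact: lt_le_trans us si.
rewrite /maxX big_nat; apply: bigmax_lt => //; apply: lt; lia.
Qed.

(* [L] lists the starting points of the blocks, which covers both the disjoint
   and the sliding scheme.  The last hypothesis weights the event that the
   j-th dyadic threshold is not exceeded by the bound [g j.+1] on the next count. *)
Lemma inv_mean_Zhat_Yhat n (L : seq nat) (w : T) (x y c0 c1 H : R) (g : nat -> R) :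
  n = (b n * k n)%N -> (0 < n)%N -> L != [::] ->
  0 < c0 -> y <= c1 / 2 -> y < 1 -> 1 < c1 * (b n)%:R ->
  {in L, forall t, exc X t (b n) (1 - y) w} ->
  cnt X n (1 - y) w <= n%:R / 2 ->
  \sum_(t <- L) \1_(exc X t (b n) (1 - x / (b n)%:R)) w <= (size L)%:R / 2 :> R ->
  c0 * (k n)%:R <= cnt X n (1 - x / (b n)%:R) w ->
  (forall j, 2 ^+ j < c1 * (b n)%:R -> cnt X n (1 - 2 ^+ j / (b n)%:R) w <= g j) ->
  \sum_(t <- L) \sum_(0 <= j < b n)
     g j.+1 ^+ 2 * \1_(~` exc X t (b n) (1 - 2 ^+ j / (b n)%:R)) w
    <= (size L)%:R * H ->
  `| ((size L)%:R^-1 * \sum_(t <- L) Zhat_sl X b n t w)^-1 -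
     ((size L)%:R^-1 * \sum_(t <- L) Yhat_sl X b n t w)^-1 |
  <= 2 / (b n)%:R / (c0 / 2) ^+ 2 * ((g 0%N ^+ 2 + H) / (k n)%:R ^+ 2).
Proof.
move=> nbk n0 L0 hc0 yc1 y1 hb1 ha hb hc hd he hf.
have b0 : 0 < (b n)%:R :> R by rewrite ltr0n; lia.
have k0 : 0 < (k n)%:R :> R by rewrite ltr0n; lia.
have l0 : 0 < (size L)%:R :> R by rewrite ltr0n; case: (L) L0.
have nE : n%:R = (b n)%:R * (k n)%:R :> R by rewrite -natrM -nbk.
(* Every block exceeds [1 - y], a level that at most half of the sample exceeds; this keeps the
   arguments of the logarithms at least 1/2. *)
have zle : {in L, forall t, 0 <= Zhat_sl X b n t w <= (b n)%:R / 2}.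
  move=> t tL; rewrite Zhat_sl_ge0//=.
  apply: le_trans (Zhat_sl_le_cnt nbk n0 (ha _ tL)) _.
  by rewrite ler_pdivrMl//; lra.
(* At least half of the blocks stay below [1 - x / b], and each of these has [Zhat >= c0]. *)
have mean : c0 / 2 <= (size L)%:R^-1 * \sum_(t <- L) Zhat_sl X b n t w.
  rewrite ler_pdivlMl//; apply: (@le_trans _ _
      (\sum_(t <- L) c0 * (1 - \1_(exc X t (b n) (1 - x / (b n)%:R)) w))).
    rewrite -mulr_sumr big_split/= sumrN big_const_seq count_predT iter_addr_0.
    have -> : (size L)%:R * (c0 / 2) = c0 * ((size L)%:R / 2) by ring.
    by rewrite ler_pM2l//; lra.
  apply: ler_sum => t _; rewrite indicE; have [_|] := boolP (w \in _).
    by rewrite subrr mulr0 Zhat_sl_ge0.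
  rewrite notin_setE subr0 mulr1 => /(cnt_le_Zhat_sl nbk n0); apply: le_trans.
  by rewrite ler_pdivlMl// mulrC.
have sq : {in L, forall t, Zhat_sl X b n t w ^+ 2 <= (g 0%N ^+ 2 + \sum_(0 <= j < b n)
     g j.+1 ^+ 2 * \1_(~` exc X t (b n) (1 - 2 ^+ j / (b n)%:R)) w) / (k n)%:R ^+ 2}.
  (* Let [J] be the least [j] whose dyadic level the block exceeds. Then [Zhat <= g J / k], and for
     [J = j.+1] the indicator at [j] equals 1, so one term of the sum suffices. *)
  move=> t tL; pose Q j := `[< exc X t (b n) (1 - 2 ^+ j / (b n)%:R) w >].
  have exQ : exists j, Q j.
    exists (b n); apply/asboolP; apply: le_exc (ha _ tL).
    rewrite lerD2l lerN2 ler_pdivlMr//.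
    have : (b n)%:R <= 2 ^+ b n :> R by rewrite -natrX ler_nat ltnW// ltn_expl.
    by apply: le_trans; rewrite ger_pMl// ltW.
  have [J /asboolP QJ Jmin] := ex_minnP exQ.
  have sum0 (r : seq nat) : 0 <= \sum_(j <- r)
      g j.+1 ^+ 2 * \1_(~` exc X t (b n) (1 - 2 ^+ j / (b n)%:R)) w.
    by apply: sumr_ge0 => j _; rewrite mulr_ge0 ?sqr_ge0.
  have Zg j : 2 ^+ j < c1 * (b n)%:R -> J = j ->
      Zhat_sl X b n t w ^+ 2 <= g j ^+ 2 / (k n)%:R ^+ 2.
    move=> /he cj Jj; rewrite -expr_div_n; have h := Zhat_sl_le_cnt nbk n0 QJ.
    have z0 := Zhat_sl_ge0 t w nbk n0.
    have zg : Zhat_sl X b n t w <= g j / (k n)%:R.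
      by apply: le_trans h _; rewrite mulrC ler_pM2r ?invr_gt0// Jj.
    by rewrite lerXn2r// nnegrE//; exact: le_trans zg.
  case: J Jmin QJ Zg => [|j] Jmin QJ Zg.
    apply: le_trans (Zg 0%N _ erefl) _; first by rewrite expr0.
    by rewrite ler_pM2r ?invr_gt0 ?exprn_gt0// lerDl.
  have nQ : ~ exc X t (b n) (1 - 2 ^+ j / (b n)%:R) w.
    by move=> /asboolP/(Jmin j); rewrite ltnn.
  (* The block exceeds [1 - y] but not the [j]-th level, so that level lies above [1 - y]. With
     [y <= c1 / 2] the next level is still in the range of the count bounds. *)
  have jy : 2 ^+ j < y * (b n)%:R.
    rewrite ltNge; apply/negP => h; apply: nQ; apply: le_exc (ha _ tL).
    by rewrite lerD2l lerN2 ler_pdivlMr.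
  have jb : (j < b n)%N.
    have : 2 ^+ j < (b n)%:R :> R.
      by apply: lt_trans jy _; rewrite gtr_pMl.
    by rewrite -natrX ltr_nat; apply: leq_trans; rewrite ltnS ltnW// ltn_expl.
  apply: le_trans (Zg j.+1 _ erefl) _.
    rewrite exprS; apply: lt_le_trans (_ : 2 * (y * (b n)%:R) <= _).
      by rewrite ltr_pM2l.
    by rewrite mulrA ler_pM2r//; lra.
  rewrite ler_pM2r ?invr_gt0 ?exprn_gt0//.
  apply: le_trans (_ : \sum_(0 <= j < b n)
     g j.+1 ^+ 2 * \1_(~` exc X t (b n) (1 - 2 ^+ j / (b n)%:R)) w <= _); last first.
    by rewrite lerDr sqr_ge0.
  rewrite (bigD1_seq j)/= ?iota_uniq ?mem_index_iota//.
  rewrite [X in _ * X]indicE mem_set// mulr1 lerDl.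
  by apply: sumr_ge0 => i _; rewrite mulr_ge0 ?sqr_ge0.
have -> : \sum_(t <- L) Yhat_sl X b n t w =
    \sum_(t <- L) - (b n)%:R * ln (1 - Zhat_sl X b n t w / (b n)%:R).
  apply: eq_bigr => t _; rewrite /Yhat_sl /Zhat_sl; congr (_ * ln _).
  by field; rewrite gt_eqF.
apply: le_trans (inv_mean_log_diff b0 _ zle mean) _; first exact: divr_gt0.
apply: ler_wpM2l; first by rewrite !divr_ge0 ?sqr_ge0 ?(ltW b0).
rewrite ler_pdivrMl//; apply: le_trans (_ : \sum_(t <- L) (g 0%N ^+ 2 + \sum_(0 <= j < b n)
     g j.+1 ^+ 2 * \1_(~` exc X t (b n) (1 - 2 ^+ j / (b n)%:R)) w) / (k n)%:R ^+ 2 <= _).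
  by rewrite !big_seq; apply: ler_sum => t tL; exact: sq.
rewrite -mulr_suml mulrA ler_pM2r ?invr_gt0 ?exprn_gt0//.
rewrite big_split/= big_const_seq count_predT iter_addr_0 mulrDr.
by rewrite [(size L)%:R * g 0%N ^+ 2]mulr_natl lerD2l.
Qed.

Lemma measurable_maxX t m : measurable_fun [set: T] (maxX X t m).
Proof. exact: measurable_bigmax. Qed.

Lemma measurable_Nhat_sl n t : measurable_fun [set: T] (Nhat_sl X b n t).
Proof.
apply: measurable_funM => //; apply: measurable_sum => s.
rewrite (_ : (fun w => _) = \1_[set w | X s w <= maxX X t (b n) w]).
  by apply: measurable_indic; apply: measurable_le_fun => //; exact: measurable_maxX.
apply/funext => w; rewrite indicE; congr (nat_of_bool _)%:R.
by apply/idP/idP; rewrite inE.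
Qed.

Lemma measurable_Zhat_sl n t : measurable_fun [set: T] (Zhat_sl X b n t).
Proof.
apply: measurable_funM => //; apply: measurable_funB => //.
exact: measurable_Nhat_sl.
Qed.

Lemma measurable_Yhat_sl n t : measurable_fun [set: T] (Yhat_sl X b n t).
Proof.
apply: measurable_funM => //; apply: measurableT_comp => //.
exact: measurable_Nhat_sl.
Qed.

Lemma Nhat_sl_ge0_le1 n t w : 0 <= Nhat_sl X b n t w <= 1.
Proof.
(* For [n = 0] the inverse of 0 is 0 by convention. *)
rewrite /Nhat_sl /Fhat; case: n => [|n]; first by rewrite invr0 mul0r lexx ler01.
rewrite mulr_ge0 ?invr_ge0 ?sumr_ge0//= ler_pdivrMl// mulr1.
apply: le_trans (_ : \sum_(1 <= s < n.+2) (1 : R) <= _); last first.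
  by rewrite sumr_const_nat subn1.
by apply: ler_sum => s _; rewrite (ler_nat _ _ 1) leq_b1.
Qed.

Lemma Yhat_sl_ge0 n t w : 0 <= Yhat_sl X b n t w.
Proof.
rewrite /Yhat_sl mulNr -mulrN mulr_ge0// oppr_ge0; apply: ln_le0.
by have /andP[] := Nhat_sl_ge0_le1 n t w.
Qed.

(** On nonnegative reals, 0 included, the inverse coincides with the real power of exponent -1, a
    measurable function. *)
Lemma measurable_inv_ge0 (f : T -> R) : measurable_fun [set: T] f ->
  (forall w, 0 <= f w) -> measurable_fun [set: T] (fun w => (f w)^-1).
Proof.
move=> mf f0; rewrite (_ : (fun w => _) = (fun w => f w `^ -1)).
  exact: (measurableT_comp (measurable_powR (-1)) mf).
by apply/funext => w; rewrite powR_inv1.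
Qed.

Lemma measurable_inv_mean_diff n (L : seq nat) (e : R) :
  measurable [set w | e < `|Num.sqrt (k n)%:R *
    (((size L)%:R^-1 * \sum_(t <- L) Zhat_sl X b n t w)^-1 -
     ((size L)%:R^-1 * \sum_(t <- L) Yhat_sl X b n t w)^-1)| ].
Proof.
apply: measurable_lt_fun => //; apply: measurableT_comp => //.
apply: measurable_funM => //; apply: measurable_funB; apply: measurable_inv_ge0.
- by apply: measurable_funM => //; apply: measurable_sum; exact: measurable_Zhat_sl.
- move=> w; rewrite mulr_ge0 ?invr_ge0// sumr_ge0// => t _.
  rewrite mulr_ge0// subr_ge0; by have /andP[] := Nhat_sl_ge0_le1 n t w.
- by apply: measurable_funM => //; apply: measurable_sum; exact: measurable_Yhat_sl.
- move=> w; rewrite mulr_ge0 ?invr_ge0// sumr_ge0// => t _; exact: Yhat_sl_ge0.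
Qed.

End BlockMeans.

Lemma leq_4half m : (2 <= m)%N -> (m <= 4 * m./2)%N.
Proof. lia. Qed.

Lemma leq_mul_half a m : (2 * a * m./2 <= a * m)%N.
Proof. by rewrite (mulnC 2) -mulnA leq_mul2l; apply/orP; right; lia. Qed.

Lemma sum_geom_le {R : realFieldType} (q : R) m : 0 <= q < 1 ->
  \sum_(0 <= j < m) q ^+ j <= (1 - q)^-1.
Proof.
move=> /andP[q0 q1]; rewrite -[leRHS]mul1r ler_pdivlMr ?subr_gt0//.
suff -> : (\sum_(0 <= j < m) q ^+ j) * (1 - q) = 1 - q ^+ m.
  by rewrite gerBl exprn_ge0.
elim: m => [|m IH]; first by rewrite big_nil mul0r expr0 subrr.
by rewrite big_nat_recr//= mulrDl IH exprS; ring.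
Qed.

Lemma near_natr_ge {R : realType} (F : set_system nat) (u : nat -> nat) (M : R) :
  u n @[n --> F] --> \oo -> \forall n \near F, M <= (u n)%:R.
Proof. by move=> cu; apply: (cu [set m | M <= m%:R]); exact: nbhs_infty_ger. Qed.

(** * Probabilities of the exceptional events for counts and blocks *)

Section EventBounds.
Context {d : measure_display} {T : measurableType d} {R : realType}.
Variables (P : probability T R) (X : nat -> {RV P >-> R}).
Hypotheses (Fcont : continuous (F X)) (Xstat : stationary X).

(** The union is encoded as the event that the number of occurring [A j] is at least 1, which turns
    the union bound into Markov's inequality. *)
Lemma Pr_union_le (A : nat -> set T) m : (forall j, measurable (A j)) ->
  Pr P [set w | 1 <= \sum_(0 <= j < m) 1 * \1_(A j) w :> R] <=
    \sum_(0 <= j < m) Pr P (A j).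
Proof.
move=> mA; apply: le_trans (markov_indic_comb P mA ltr01 _) _.
  by move=> w; apply: sumr_ge0 => j _; rewrite mul1r.
by rewrite divr1; under eq_bigr do rewrite mul1r.
Qed.

(* Thresholds outside the range of (A4) are discarded by the empty set. *)
Definition dyadic_excess (n B K : nat) (c1 kap rho : R) (j : nat) : set T :=
  if 2 ^+ j < c1 * B%:R then
    [set w | n%:R * (1 - (1 - 2 ^+ j / B%:R)) + kap * K%:R * (2 * rho) ^+ j
             <= cnt X n (1 - 2 ^+ j / B%:R) w]
  else set0.

Lemma measurable_dyadic_excess n B K c1 kap rho j :
  measurable (dyadic_excess n B K c1 kap rho j).
Proof.
rewrite /dyadic_excess; case: ifP => // _.
by apply: measurable_le_fun => //; exact: measurable_cnt.
Qed.

(** At level [j] the variance is at most [2 C1 (K 2^j)^2], since [K 2^j >= 1]. Chebyshev with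
    deviation [kap K (2 rho)^j] leaves [rho^(-2 j)], a summable series. *)
Lemma Pr_dyadic_excess n B K (c1 C1 kap rho : R) :
  (forall y, 0 < y < c1 ->
    ('V_P[cnt X n (1 - y)] <= (C1 * (n%:R * y + n%:R ^+ 2 * y ^+ 2))%:E)%E) ->
  n = (B * K)%N -> (0 < n)%N -> 0 < C1 -> 0 < kap -> 1 < rho ->
  Pr P [set w | 1 <= \sum_(0 <= j < B) 1 * \1_(dyadic_excess n B K c1 kap rho j) w :> R]
    <= 2 * C1 / kap ^+ 2 * (1 - rho ^- 2)^-1.
Proof.
move=> hV nBK n0 C10 kap0 rho1.
have B0 : 0 < B%:R :> R by rewrite ltr0n; lia.
have K0 : 0 < K%:R :> R by rewrite ltr0n; lia.
have K1 : 1 <= K%:R :> R by rewrite ler1n; lia.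
have nE : n%:R = B%:R * K%:R :> R by rewrite -natrM -nBK.
have rho0 : 0 < rho by lra.
have r2 : 0 <= rho ^- 2 < 1.
  by rewrite invr_ge0 exprn_ge0 ?(ltW rho0)//= invf_lt1 ?exprn_gt0// expr_gt1// ltW.
apply: le_trans (Pr_union_le _ _) _; first exact: measurable_dyadic_excess.
have c0 : 0 <= 2 * C1 / kap ^+ 2 by apply: divr_ge0; [lra|exact: sqr_ge0].
apply: le_trans (ler_wpM2l c0 (sum_geom_le B r2)).
rewrite mulr_sumr; apply: ler_sum => j _.
rewrite /dyadic_excess; case: ifP => h; last first.
  by rewrite /Pr measure0 mulr_ge0// exprn_ge0//; have /andP[] := r2.
have p0 : 0 < 2 ^+ j :> R by exact: exprn_gt0.
have rj0 : 0 < (2 * rho) ^+ j by rewrite exprn_gt0 ?mulr_gt0.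
have y1 : 0 < (2 : R) ^+ j / B%:R < c1 by rewrite divr_gt0//= ltr_pdivrMr.
have e0 : 0 < kap * K%:R * (2 * rho) ^+ j by rewrite !mulr_gt0.
have u1 : 1 - (2 : R) ^+ j / B%:R < 1 by rewrite ltrBlDr ltrDl; have /andP[] := y1.
apply: le_trans (Pr_cnt_chebyshev Fcont Xstat u1 e0 (hV _ y1)) _.
rewrite ler_pdivrMr ?exprn_gt0//.
have -> : 2 * C1 / kap ^+ 2 * (rho ^- 2) ^+ j * (kap * K%:R * (2 * rho) ^+ j) ^+ 2 =
    C1 * (2 * (K%:R * 2 ^+ j) ^+ 2).
  have -> : (rho ^- 2) ^+ j = (rho ^+ j) ^- 2 by rewrite exprVn -!exprM mulnC.
  rewrite (exprMn j 2 rho).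
  by field; rewrite !gt_eqF ?exprn_gt0.
have -> : n%:R * (2 ^+ j / B%:R) + n%:R ^+ 2 * (2 ^+ j / B%:R) ^+ 2 =
    K%:R * 2 ^+ j + (K%:R * 2 ^+ j) ^+ 2 :> R.
  by rewrite nE; field; rewrite gt_eqF.
rewrite ler_pM2l//.
have a1 : 1 <= K%:R * 2 ^+ j :> R by rewrite mulr_ege1// exprn_ege1// ler1n.
suff : K%:R * 2 ^+ j <= (K%:R * 2 ^+ j) ^+ 2 :> R by lra.
by rewrite expr2 ler_peMl//; lra.
Qed.

(** Here and in [Pr_sum_nexc] only expectations enter, so overlapping blocks are treated like
    disjoint ones. *)
Lemma Pr_sum_exc (L : seq nat) m (u : R) : {in L, forall t, (1 <= t)%N} ->
  L != [::] -> u < 1 ->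
  Pr P [set w | (size L)%:R / 2 <= \sum_(t <- L) 1 * \1_(exc X t m u) w :> R]
    <= 2 * (m%:R * (1 - u)).
Proof.
move=> hL L0 u1; have l0 : 0 < (size L)%:R :> R by rewrite ltr0n; case: (L) L0.
apply: le_trans (markov_indic_comb P _ _ _) _.
- by move=> t; exact: measurable_exc.
- by rewrite divr_gt0.
- by move=> w; apply: sumr_ge0 => t _; rewrite mul1r.
rewrite ler_pdivrMr ?divr_gt0//.
have -> : 2 * (m%:R * (1 - u)) * ((size L)%:R / 2) = \sum_(t <- L) m%:R * (1 - u).
  rewrite big_const_seq count_predT iter_addr_0 -mulr_natl.
  by field.
rewrite !big_seq; apply: ler_sum => t /hL t1.
by rewrite mul1r; exact: Pr_exc_le.
Qed.

Lemma Pr_sum_nexc (L : seq nat) (B : nat) (g : nat -> R) (C q G K : R) :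
  {in L, forall t, (1 <= t)%N} -> L != [::] -> 0 < K -> 0 <= q < 1 ->
  0 <= G ->
  (forall j, g j * Pr P (~` exc X 1 B (1 - 2 ^+ j / B%:R)) <= G * q ^+ j) ->
  (forall j, 0 <= g j) ->
  Pr P [set w | (size L)%:R * K <= \sum_(x <- [seq (t, j) | t <- L, j <- index_iota 0 B])
          g x.2 * \1_(~` exc X x.1 B (1 - 2 ^+ x.2 / B%:R)) w]
    <= G * (1 - q)^-1 / K.
Proof.
move=> hL L0 K0 q01 G0 hg g0; have l0 : 0 < (size L)%:R :> R by rewrite ltr0n; case: (L) L0.
apply: le_trans (markov_indic_comb P _ _ _) _.
- by move=> x; apply: measurableC; exact: measurable_exc.
- by rewrite mulr_gt0.
- by move=> w; apply: sumr_ge0 => x _; rewrite mulr_ge0.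
rewrite big_allpairs/= invfM mulrA ler_pM2r ?invr_gt0// ler_pdivrMr//.
have -> : G * (1 - q)^-1 * (size L)%:R = \sum_(t <- L) G * (1 - q)^-1.
  by rewrite big_const_seq count_predT iter_addr_0 mulr_natr.
rewrite !big_seq; apply: ler_sum => t /hL t1.
apply: le_trans (ler_wpM2l G0 (sum_geom_le B q01)).
rewrite mulr_sumr; apply: ler_sum => j _; apply: le_trans (hg j).
rewrite !PrC; try exact: measurable_exc.
by rewrite (Pr_exc Fcont Xstat).
Qed.

End EventBounds.

(** * Half blocks inside arbitrary blocks, and the lower bound on the count *)

Section Main.
Context {d : measure_display} {T : measurableType d} {R : realType}.
Variables (P : probability T R) (X : nat -> {RV P >-> R}).
Variables (S : set nat) (b k : nat -> nat) (theta : R).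
Hypotheses (Xstat : stationary X) (Fcont : continuous (F X)).

Lemma measurable_Nhalf n i : measurable_fun [set: T] (Nhalf X b n i).
Proof. by apply: measurable_bigmax => // s; exact: measurable_U. Qed.

(** Every window of length [b] within the sample contains a complete half block, so a lower bound on
    all half-block maxima holds for disjoint and sliding blocks alike. *)
Lemma exc_of_Nhalf n c w t : n = (b n * k n)%N -> (0 < n)%N -> 0 <= c ->
  c < \big[Num.min/1]_(1 <= i < (2 * k n).+1) Nhalf X b n i w ->
  (1 <= t)%N -> (t + b n <= n.+1)%N -> exc X t (b n) c w.
Proof.
move=> nbk n0 c0 hN t1 tb.
have b0 : (0 < b n)%N by lia.
(* [q] is the ceiling of [2 (t - 1) / b], so [q.+1] numbers the first half block that starts at or
   after [t]; it ends before [t + b], also for odd [b]. *)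
pose q := ((2 * (t - 1) + (b n - 1)) %/ b n)%N.
have qle : (q * b n <= 2 * (t - 1) + (b n - 1))%N by exact: leq_trunc_div.
have qge : (2 * (t - 1) + (b n - 1) < q * b n + b n)%N.
  by have := ltn_ceil (2 * (t - 1) + (b n - 1)) b0; rewrite -/q mulSn; lia.
have qk : (q.+1 < (2 * k n).+1)%N.
  rewrite ltnS -(ltn_pmul2r b0).
  by apply: leq_ltn_trans qle _; nia.
have : c < Nhalf X b n q.+1 w.
  apply: lt_le_trans hN _; apply: (@bigmin_inf_seq _ _ _ _ _ q.+1) => //.
  by rewrite mem_index_iota.
rewrite ltNge => /negP nN; apply: contrapT => nE; apply: nN.
rewrite /Nhalf big_nat_cond; apply: bigmax_le => // s /andP[hs].
rewrite subn1 /= mulSn => hq; rewrite leNgt; apply/negP => hU; apply: nE.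
exists s => //; lia.
Qed.

Hypotheses (nbk : forall n, S n -> n = (b n * k n)%N)
  (kcvg : k n @[n --> within S \oo] --> \oo)
  (bcvg : b n @[n --> within S \oo] --> \oo).

(* Only every other block is counted, so that distinct blocks are separated by a
   gap of length b and alpha (b) <= C2 / b bounds all the covariances. *)
Lemma near_cnt_lower (c2 C2 eta x : R) : extremal_index X theta -> 0 < theta ->
  0 < c2 -> 0 < C2 -> 1 <= eta ->
  (forall l : nat, (1 <= l)%N -> alpha_eps X c2 l <= C2 * l%:R `^ (- eta)) ->
  0 < x -> exists2 c0 : R, 0 < c0 & forall e, 0 < e ->
  \forall n \near within S \oo,
    Pr P [set w | cnt X n (1 - x / (b n)%:R) w <= c0 * (k n)%:R] <= e.
Proof.
move=> hE t0 c20 C20 eta1 hal x0.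
have [p0 p00 hp0] := exc_extremal_index Fcont hE t0 x0.
(* With [m] the integer part of [k / 2], [m >= k / 4]; Chebyshev gives up another factor 2. *)
exists (p0 / 8); first by lra.
move=> e e0; near=> n.
have Sn : S n by near: n; exact: withinT.
have n_bk := nbk Sn.
have hp : p0 <= Pr P (exc X 1 (b n) (1 - x / (b n)%:R)) by near: n; exact: bcvg hp0.
have B1 : 1 <= (b n)%:R :> R by near: n; exact: near_natr_ge.
have K2 : 2 <= (k n)%:R :> R by near: n; exact: near_natr_ge.
have Bx : x <= (b n)%:R by near: n; exact: near_natr_ge.
have Bx2 : x / c2 <= (b n)%:R by near: n; exact: near_natr_ge.
(* [Ke] and [Be] make the variance term [m^-1] and the covariance term [C2 / B] at most [e p0^2 / 8]
   each; multiplied by [4 / p0^2], they add up to at most [e]. *)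
have Ke : 32 / (e * p0 ^+ 2) <= (k n)%:R by near: n; exact: near_natr_ge.
have Be : 8 * C2 / (e * p0 ^+ 2) <= (b n)%:R by near: n; exact: near_natr_ge.
set B := b n in n_bk hp B1 Bx Bx2 Be *; set K := k n in n_bk K2 Ke *.
have B0 : 0 < B%:R :> R by lra.
have B0' : (0 < B)%N by rewrite -(ltr0n R).
have K2' : (2 <= K)%N by rewrite -(ler_nat R).
set u := 1 - x / B%:R in hp *; set p := Pr P _ in hp.
have u0 : 0 <= u by rewrite subr_ge0 ler_pdivrMr ?mul1r.
(* This puts the level in the part of the tail that is controlled by [alpha_eps X c2]. *)
have u2 : 1 - c2 <= u by rewrite lerD2l lerN2 ler_pdivrMr// mulrC -ler_pdivrMr.
pose m := K./2; pose A i := exc X (2 * B * i + 1) B u.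
have mA i : measurable (A i) by exact: measurable_exc.
have pA i : Pr P (A i) = p by rewrite /A Pr_exc// addn1.
have hB : alpha_eps X c2 B <= C2 / B%:R.
  apply: le_trans (hal _ B0') _; rewrite ler_pM2l//.
  rewrite -powR_inv1 ?(ltW B0)//; apply: ler_powR => //; lra.
have cA' i j : (i < j)%N -> Pr P (A i `&` A j) <= p ^+ 2 + C2 / B%:R.
  move=> ij; have ht : (2 * B * i + 1 + B + B <= (2 * B * j + 1).+1)%N.
    have : (2 * B * i.+1 <= 2 * B * j)%N by rewrite leq_mul2l ij orbT.
    by rewrite mulnS -mulnA; move: (B * i)%N (2 * B * j)%N; clear; lia.
  have t1 : (1 <= 2 * B * i + 1)%N by rewrite addn1.
  have := Pr_excI_le Fcont t1 B0' ht u2 u0; rewrite -/(A i) -/(A j) !pA -expr2.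
  by move=> hi; apply: le_trans hi _; rewrite lerD2l.
have cA i j : i != j -> Pr P (A i `&` A j) <= p ^+ 2 + C2 / B%:R.
  rewrite neq_ltn => /orP[|] ij; first exact: cA'.
  by rewrite setIC; exact: cA'.
have pp : 0 < p by lra.
have m0 : (0 < m)%N by rewrite half_gt0.
have m0' : 0 < m%:R :> R by rewrite ltr0n.
have mK : K%:R <= 4 * m%:R :> R by rewrite -natrM ler_nat; exact: leq_4half.
have cB0 : 0 <= C2 / B%:R by rewrite divr_ge0 ?ltW.
have := chebyshev_events mA pA cA cB0 pp m0.
move=> hC; apply: le_trans (le_trans hC _).
  apply: le_Pr.
  - by apply: measurable_le_fun => //; exact: measurable_cnt.
  - by apply: measurable_le_fun => //; apply: measurable_sum => i; exact: measurable_indic.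
  move=> w /=; have le : (2 * B * m <= n)%N.
    by rewrite [X in (_ <= X)%N]n_bk; exact: leq_mul_half.
  have := cnt_ge_blocks X u w le; rewrite -/(A _) => h1 h2.
  apply: le_trans (le_trans h1 h2) _.
  have : p0 * K%:R <= p * (4 * m%:R) by apply: ler_pM => //; exact: ltW.
  lra.
have p2 : 0 < p0 ^+ 2 by exact: exprn_gt0.
have K0 : 0 < K%:R :> R by lra.
have h1 : m%:R^-1 <= 4 / K%:R :> R.
  by rewrite ler_pdivlMr// mulrC ler_pdivrMr.
have h2 : 4 / K%:R <= e * p0 ^+ 2 / 8.
  move: Ke; rewrite ler_pdivrMr ?mulr_gt0// => Ke.
  by rewrite ler_pdivrMr//; lra.
have h3 : C2 / B%:R <= e * p0 ^+ 2 / 8.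
  move: Be; rewrite ler_pdivrMr ?mulr_gt0// => Be.
  by rewrite ler_pdivrMr//; lra.
have h4 : 4 / p ^+ 2 <= 4 / p0 ^+ 2.
  by rewrite ler_pM2l// lef_pV2 ?posrE ?exprn_gt0// lerXn2r ?nnegrE; lra.
apply: (@le_trans _ _ ((e * p0 ^+ 2 / 4) * (4 / p0 ^+ 2))).
  by apply: ler_pM => //; rewrite ?addr_ge0 ?invr_ge0 ?divr_ge0 ?sqr_ge0//; lra.
by rewrite le_eqVlt; apply/orP; left; apply/eqP; field; rewrite gt_eqF.
Unshelve. all: by end_near. Qed.

End Main.

(* rho = 2^(delta / 4) leaves a geometric margin rho^-2 in the product of the
   tails (4 rho^4)^-j of the blocks and of the squared counts (4 rho^2)^j. *)
Lemma powR_dyadic {R : realType} (delta : R) : 0 < delta -> exists2 rho : R, 1 < rho &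
  forall j, (2 ^+ j : R) `^ (2 + delta) = (4 * rho ^+ 4) ^+ j.
Proof.
move=> d0; exists (2 `^ (delta / 4)).
  have h : 0 < delta / 4 by rewrite divr_gt0.
  have n2 : (2 : R) \in Num.nneg by rewrite nnegrE.
  have n1 : (1 : R) \in Num.nneg by rewrite nnegrE.
  have l12 : (1 : R) < 2 by rewrite ltr1n.
  by have := gt0_ltr_powR h n1 n2 l12; rewrite powR1.
move=> j; transitivity ((2 `^ (2 + delta)) ^+ j).
  by rewrite -(powR_mulrn j (powR_ge0 _ _)) -(powR_mulrn j (ler0n _ 2)) -!powRrM mulrC.
congr (_ ^+ j); rewrite powRD ?pnatr_eq0 ?implybT//; congr (_ * _).
  by rewrite (powR_mulrn 2)// expr2 -natrM.
by rewrite -powR_mulrn ?powR_ge0// -powRrM; congr (_ `^ _); field.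
Qed.

(** The factor 16 is 4 from squaring [2 kap K] times 4 from the shift to [j.+1], which also yields
    [rho^2]. *)
Lemma dyadic_weight_tail {R : realFieldType} (kap K rho C : R) j : 0 < rho ->
  (2 * kap * K * (2 * rho) ^+ j.+1) ^+ 2 * (C / (4 * rho ^+ 4) ^+ j) =
  16 * kap ^+ 2 * K ^+ 2 * rho ^+ 2 * C * (rho ^- 2) ^+ j.
Proof.
move=> rho0.
have -> : (rho ^- 2) ^+ j = (rho ^+ j) ^- 2 by rewrite exprVn -!exprM mulnC.
have -> : (4 * rho ^+ 4) ^+ j = (2 ^+ j) ^+ 2 * (rho ^+ j) ^+ 4.
  rewrite -!exprM ![(j * _)%N]mulnC (exprM _ 2 j) (exprM _ 4 j) -exprMn.
  by congr ((_ * _) ^+ _); rewrite expr2 -natrM.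
rewrite [(2 * rho) ^+ j.+1]exprS (exprMn j 2 rho); field.
by rewrite !gt_eqF ?exprn_gt0.
Qed.

(** * Assembly of the exceptional events and application to both block schemes *)

Lemma le_PrU {d : measure_display} {T : measurableType d} {R : realType}
    (P : probability T R) (A B : set T) (x y : R) : measurable A -> measurable B ->
  Pr P A <= x -> Pr P B <= y -> Pr P (A `|` B) <= x + y.
Proof. by move=> mA mB Ax By; apply: le_trans (PrU P mA mB) (lerD Ax By). Qed.

(** Six exceptional events [Ea] to [Ef], each of probability at most [h = e / 6], negate the
    hypotheses of [inv_mean_Zhat_Yhat]. Off their union the difference is at most [D / b], and
    [k = o(b^2)] gives [sqrt k D / b <= eps] eventually. *)
Lemma inv_mean_diff_oP1 (d : measure_display) (T : measurableType d) (R : realType)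
    (P : probability T R) (X : nat -> {RV P >-> R})
    (S : set nat) (b k : nat -> nat) (theta delta : R) (L : nat -> seq nat) :
  stationary X -> continuous (F X) -> block_scheme S b k ->
  extremal_index X theta -> 0 < theta -> 0 < delta -> A3 X S b k delta ->
  A4 X -> A5 X S b k -> A6 X delta ->
  (forall n, S n -> (0 < n)%N -> L n != [::] /\
     {in L n, forall t, (1 <= t)%N /\ (t + b n <= n.+1)%N}) ->
  is_oP1 P S (fun n w => Num.sqrt (k n)%:R *
    (((size (L n))%:R^-1 * \sum_(t <- L n) Zhat_sl X b n t w)^-1 -
     ((size (L n))%:R^-1 * \sum_(t <- L n) Yhat_sl X b n t w)^-1)).
Proof.
move=> Xstat Fcont [_ nbk kcvg] hE t0 d0.
move=> [c2 [C2 [mu [eta [/andP[c20 c21] C20 /andP[mu0]]]]]].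
rewrite lt_min => /andP[mud _] heta [hal bcvg ko _].
move=> [c1 [C1 [/andP[c10 c11] C10 hV]]] h5 h6 hL eps eps0.
(* The required lower bound on [eta] exceeds 1, as [delta - mu < delta]. *)
have eta1 : 1 <= eta.
  apply: le_trans heta; rewrite ler_pdivlMr ?subr_gt0//; lra.
have [C C0 hC] := Z_tail Fcont h6 d0.
apply/cvgrPdist_le => e e0.
pose h := e / 6; have h0 : 0 < h by rewrite divr_gt0.
(* A block exceeds [1 - x / b] with probability at most [x], hence half of the blocks do so with
   probability at most [2 x = h]. *)
pose x := h / 2; have x0 : 0 < x by rewrite divr_gt0.
(* [c1 / 2] keeps the dyadic levels in the range of (A4), [1 / 2] keeps [1 - y] inside [(0, 1)], and
   [h / 2] makes the Markov bound [2 y] for [Eb] at most [h]. *)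
pose y := Num.min (c1 / 2) (Num.min (1 / 2) (h / 2)).
have y0 : 0 < y by rewrite !lt_min; apply/and3P; split; lra.
have [yc1 [y2 yh]] : y <= c1 / 2 /\ y <= 1 / 2 /\ y <= h / 2.
  by rewrite /y !ge_min !lexx !orbT.
have [c0 c00 hc0] := near_cnt_lower Xstat Fcont nbk kcvg bcvg hE t0 c20 C20 eta1 hal x0.
have [rho rho1 powE] := powR_dyadic d0.
have rho0 : 0 < rho by lra.
have q01 : 0 <= rho ^- 2 < 1.
  by rewrite invr_ge0 exprn_ge0 ?(ltW rho0)//= invf_lt1 ?exprn_gt0// expr_gt1// ltW.
pose Sg := (1 - rho ^- 2)^-1.
have Sg0 : 0 < Sg by rewrite invr_gt0 subr_gt0; case/andP: q01.
(* This gives [2 C1 Sg <= h kap <= h kap^2], which bounds [Ee]; [kap >= 1] also lets [kap] absorb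
   the mean of the counts. [H0] below is chosen so that the Markov bound for [Ef] equals [h]. *)
pose kap := 1 + 2 * C1 * Sg / h.
have kap1 : 1 <= kap by rewrite lerDl divr_ge0 ?(ltW h0)// !mulr_ge0// ltW.
have kap0 : 0 < kap by lra.
pose H0 := 16 * kap ^+ 2 * rho ^+ 2 * C * Sg / h.
have H00 : 0 < H0 by rewrite divr_gt0// !mulr_gt0// exprn_gt0.
pose D := 2 / (c0 / 2) ^+ 2 * (4 * kap ^+ 2 + H0).
have D0 : 0 < D.
  by rewrite mulr_gt0 ?divr_gt0 ?exprn_gt0 ?divr_gt0// addr_gt0// mulr_gt0// exprn_gt0.
have y1 : 0 < 1 - y < 1 by apply/andP; split; lra.
have FF : Filter (within S \oo) by exact: within_filter.
have nearA := cvgr0_norm_le _ (h5 (1 - y) y1) h h0.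
have nearK : \forall n \near within S \oo,
    `|(k n)%:R : R| <= (eps / D) ^+ 2 * `|(b n)%:R ^+ 2 : R|.
  by move/eqoP: ko; apply; rewrite exprn_gt0// divr_gt0.
near=> n.
have Sn : S n by near: n; exact: withinT.
have n_bk := nbk _ Sn.
have nA : `|Pr P [set w | \big[Num.min/1]_(1 <= i < (2 * k n).+1) Nhalf X b n i w <= 1 - y]|
    <= h by near: n; exact: nearA.
have nD : Pr P [set w | cnt X n (1 - x / (b n)%:R) w <= c0 * (k n)%:R] <= h.
  by near: n; exact: hc0.
have nF : forall z, 0 < z -> Pr P (~` exc X 1 (b n) (1 - z / (b n)%:R)) <=
    C / z `^ (2 + delta) by near: n; exact: bcvg hC.
have nK : `|(k n)%:R : R| <= (eps / D) ^+ 2 * `|(b n)%:R ^+ 2 : R|.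
  by near: n; exact: nearK.
have b1 : 1 <= (b n)%:R :> R by near: n; exact: near_natr_ge.
have k1 : 1 <= (k n)%:R :> R by near: n; exact: near_natr_ge.
have bc1 : 2 / c1 <= (b n)%:R by near: n; exact: near_natr_ge.
have b0 : 0 < (b n)%:R :> R by exact: lt_le_trans b1.
have k0 : 0 < (k n)%:R :> R by exact: lt_le_trans k1.
have n0 : (0 < n)%N by rewrite n_bk muln_gt0 -!(ltr0n R) b0 k0.
have nE : n%:R = (b n)%:R * (k n)%:R :> R by rewrite -natrM -n_bk.
have [L0 Lin] := hL n Sn n0.
have Lt1 : {in L n, forall t, (1 <= t)%N} by move=> t /Lin[].
have l0 : 0 < (size (L n))%:R :> R by rewrite ltr0n; case: (L n) L0.
(* One half of [g j] dominates the mean bound [k 2^j] of the count, the other half is the deviation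
   allowed in [dyadic_excess]. *)
pose g j := 2 * kap * (k n)%:R * (2 * rho) ^+ j.
have g0 j : 0 <= g j.
  by rewrite !mulr_ge0// ?exprn_ge0 ?mulr_ge0// ltW.
pose H := (k n)%:R ^+ 2 * H0.
have HH : 0 < H by rewrite mulr_gt0// exprn_gt0.
pose Ea := [set w | \big[Num.min/1]_(1 <= i < (2 * k n).+1) Nhalf X b n i w <= 1 - y].
pose Eb := [set w | n%:R / 2 <= cnt X n (1 - y) w].
pose Ec := [set w | (size (L n))%:R / 2 <=
  \sum_(t <- L n) 1 * \1_(exc X t (b n) (1 - x / (b n)%:R)) w :> R].
pose Ed := [set w | cnt X n (1 - x / (b n)%:R) w <= c0 * (k n)%:R].
pose Ee := [set w | 1 <= \sum_(0 <= j < b n)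
  1 * \1_(dyadic_excess X n (b n) (k n) c1 kap rho j) w :> R].
pose Ef := [set w | (size (L n))%:R * H <=
  \sum_(z <- [seq (t, j) | t <- L n, j <- index_iota 0 (b n)])
    g z.2.+1 ^+ 2 * \1_(~` exc X z.1 (b n) (1 - 2 ^+ z.2 / (b n)%:R)) w].
have ma : measurable Ea.
  apply: measurable_le_fun => //; apply: measurable_bigmin => // i; exact: measurable_Nhalf.
have mb : measurable Eb by apply: measurable_le_fun => //; exact: measurable_cnt.
have mc : measurable Ec.
  apply: measurable_le_fun => //; apply: measurable_indic_comb => t.
  exact: measurable_exc.
have md : measurable Ed by apply: measurable_le_fun => //; exact: measurable_cnt.
have me : measurable Ee.
  apply: measurable_le_fun => //; apply: measurable_indic_comb => j.
  exact: measurable_dyadic_excess.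
have mf : measurable Ef.
  apply: measurable_le_fun => //; apply: measurable_indic_comb => z.
  by apply: measurableC; exact: measurable_exc.
have pa : Pr P Ea <= h.
  exact: le_trans (ler_norm _) nA.
have pb : Pr P Eb <= h.
  apply: le_trans (Pr_cnt_ge Fcont Xstat n _ _) _.
  - by rewrite ltrBlDr ltrDl.
  - by rewrite divr_gt0// ltr0n.
  have n0' : 0 < n%:R :> R by rewrite ltr0n.
  rewrite ler_pdivrMr ?divr_gt0//.
  have -> : n%:R * (1 - (1 - y)) = (2 * y) * (n%:R / 2) by field.
  by rewrite ler_pM2r ?divr_gt0// mulrC -ler_pdivlMr.
have pc : Pr P Ec <= h.
  apply: le_trans (Pr_sum_exc Fcont Xstat (b n) Lt1 L0 _) _.
    by rewrite ltrBlDr ltrDl divr_gt0.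
  rewrite le_eqVlt; apply/orP; left; apply/eqP.
  by rewrite /x; field; rewrite gt_eqF.
have pd : Pr P Ed <= h by exact: nD.
have pe : Pr P Ee <= h.
  apply: le_trans (@Pr_dyadic_excess _ _ _ _ _ Fcont Xstat n (b n) (k n)
    c1 C1 kap rho _ n_bk n0 C10 kap0 rho1) _.
    by move=> z hz; apply: hV.
  rewrite -/Sg mulrAC ler_pdivrMr ?exprn_gt0//.
  have : 2 * C1 * Sg <= h * kap.
    by rewrite mulrDr mulr1 [h * (_ / _)]mulrC divfK ?gt_eqF// lerDr ltW.
  by move=> hk; apply: le_trans hk _; rewrite ler_pM2l// expr2 ler_peMl// ltW.
have pf : Pr P Ef <= h.
  apply: le_trans (@Pr_sum_nexc _ _ _ _ _ Fcont Xstat (L n) (b n) (fun j => g j.+1 ^+ 2)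
    C (rho ^- 2) (16 * kap ^+ 2 * (k n)%:R ^+ 2 * rho ^+ 2 * C) H Lt1 L0 HH q01 _ _ _) _.
  - by rewrite !mulr_ge0// ?exprn_ge0// ltW.
  - move=> j; have p0 : 0 < (2 : R) ^+ j by rewrite exprn_gt0.
    apply: le_trans (ler_wpM2l (sqr_ge0 _) (nF _ p0)) _.
    rewrite powE le_eqVlt; apply/orP; left; apply/eqP.
    exact: dyadic_weight_tail.
  - by move=> j; exact: sqr_ge0.
  rewrite -/Sg le_eqVlt; apply/orP; left; apply/eqP.
  by rewrite /H /H0; field; rewrite !gt_eqF.
have ko' : Num.sqrt (k n)%:R <= eps / D * (b n)%:R.
  move: nK; rewrite !ger0_norm ?sqr_ge0// -exprMn => hk.
  have hd : 0 <= eps / D * (b n)%:R by rewrite mulr_ge0// divr_ge0// ltW.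
  by rewrite -(ger0_norm hd) -sqrtr_sqr ler_wsqrtr.
rewrite sub0r normrN ger0_norm ?Pr_ge0//.
apply: (@le_trans _ _ (Pr P (Ea `|` (Eb `|` (Ec `|` (Ed `|` (Ee `|` Ef))))))).
  apply: le_Pr; first exact: measurable_inv_mean_diff.
    by do !apply: measurableU.
  move=> w /= hw; apply: contrapT => hn; move: hw; apply/negP; rewrite -leNgt.
  have [[na nb nc nd ne] nf] : [/\ ~ Ea w, ~ Eb w, ~ Ec w, ~ Ed w & ~ Ee w] /\ ~ Ef w.
    split; first split.
    - by move=> hw; apply: hn; left.
    - by move=> hw; apply: hn; right; left.
    - by move=> hw; apply: hn; right; right; left.
    - by move=> hw; apply: hn; right; right; right; left.
    - by move=> hw; apply: hn; right; right; right; right; left.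
    - by move=> hw; apply: hn; right; right; right; right; right.
  clear hn nA nD nF nK pa pb pc pd pe pf ma mb mc md me mf.
  have ylt1 : y < 1 by case/andP: y1; rewrite subr_gt0.
  have cb1 : 1 < c1 * (b n)%:R.
    have : 2 <= c1 * (b n)%:R by rewrite mulrC -ler_pdivrMr.
    by apply: lt_le_trans; rewrite ltr1n.
  have ha : {in L n, forall t, exc X t (b n) (1 - y) w}.
    move=> t /Lin[t1 tb]; apply: (exc_of_Nhalf n_bk n0) => //.
      by case/andP: y1 => /ltW.
    by rewrite ltNge; apply/negP.
  have hb : cnt X n (1 - y) w <= n%:R / 2.
    by rewrite leNgt; apply/negP => /ltW.
  have hc : \sum_(t <- L n) \1_(exc X t (b n) (1 - x / (b n)%:R)) w <=
      (size (L n))%:R / 2 :> R.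
    rewrite leNgt; apply/negP => /ltW hw; apply: nc.
    by rewrite /Ec /=; under eq_bigr do rewrite mul1r.
  have hd : c0 * (k n)%:R <= cnt X n (1 - x / (b n)%:R) w.
    by rewrite leNgt; apply/negP => /ltW.
  have he j : 2 ^+ j < c1 * (b n)%:R -> cnt X n (1 - 2 ^+ j / (b n)%:R) w <= g j.
    move=> hj; have jb : (j < b n)%N.
      have : 2 ^+ j < (b n)%:R :> R by apply: lt_trans hj _; rewrite gtr_pMl.
      by rewrite -natrX ltr_nat; apply: ltn_trans; exact: ltn_expl.
    have nj : ~ dyadic_excess X n (b n) (k n) c1 kap rho j w.
      move=> hw; apply: ne; rewrite /Ee /= (bigD1_seq j)/= ?iota_uniq ?mem_index_iota//.
      rewrite [X in 1 * X]indicE mem_set// mulr1 lerDl.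
      by apply: sumr_ge0 => i _; rewrite mul1r.
    rewrite leNgt; apply/negP => gc; apply: nj; rewrite /dyadic_excess hj /=.
    apply: le_trans (ltW gc).
    have -> : n%:R * (1 - (1 - 2 ^+ j / (b n)%:R)) = (k n)%:R * 2 ^+ j :> R.
      by rewrite nE; field; rewrite gt_eqF.
    have -> : g j = kap * (k n)%:R * (2 * rho) ^+ j + kap * (k n)%:R * (2 * rho) ^+ j.
      by rewrite /g; ring.
    rewrite lerD2r (exprMn j 2 rho) [kap * _]mulrC -mulrA ler_pM2l// mulrCA.
    by rewrite ler_peMr ?exprn_ge0// mulr_ege1// exprn_ege1// ltW.
  have hf : \sum_(t <- L n) \sum_(0 <= j < b n)
      g j.+1 ^+ 2 * \1_(~` exc X t (b n) (1 - 2 ^+ j / (b n)%:R)) w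
      <= (size (L n))%:R * H.
    rewrite leNgt; apply/negP => /ltW hw; apply: nf.
    by rewrite /Ef /= big_allpairs.
  have det := inv_mean_Zhat_Yhat n_bk n0 L0 c00 yc1 ylt1 cb1 ha hb hc hd he hf.
  rewrite normrM ger0_norm ?sqrtr_ge0//.
  apply: le_trans (ler_wpM2l (sqrtr_ge0 _) det) _.
  have -> : 2 / (b n)%:R / (c0 / 2) ^+ 2 * ((g 0%N ^+ 2 + H) / (k n)%:R ^+ 2) =
      D / (b n)%:R.
    by rewrite /g /H /D expr0; field; rewrite !gt_eqF.
  by rewrite mulrA ler_pdivrMr// -ler_pdivlMr// mulrAC.
have -> : e = h + (h + (h + (h + (h + h)))) by rewrite /h; field.
by do !(apply: le_PrU => //; do ?apply: measurableU => //).
Unshelve. all: by end_near. Qed.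

Theorem theorem3p1 (d : measure_display) (T : measurableType d) (R : realType)
    (P : probability T R) (X : nat -> {RV P >-> R})
    (S : set nat) (b k : nat -> nat) (theta delta : R)
    (Xstat : stationary X) (Fcont : continuous (F X))
    (blocks : block_scheme S b k)
    (hA1 : A1 X theta) (hA2 : A2 X delta) (hA3 : A3 X S b k delta)
    (hA4 : A4 X) (hA5 : A5 X S b k) (hA6 : A6 X delta)
    (hA7 : A7 X S b k theta) (hP : condP X S b) :
  is_oP1 P S (fun n w => Num.sqrt (k n)%:R *
                         (thetaB_dj X b k n w - thetaN_dj X b k n w)) /\
  is_oP1 P S (fun n w => Num.sqrt (k n)%:R *
                         (thetaB_sl X b n w - thetaN_sl X b n w)).
Proof.
have [[/andP[t0 _] hE] _ _ _ _] := hA1; have [d0 _] := hA2.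
have nbk : forall n, S n -> n = (b n * k n)%N by case: blocks.
split.
(* Disjoint blocks are the sliding blocks that start at [(i - 1) b + 1], so their statistics agree
   by unfolding. *)
- pose L n := [seq ((i - 1) * b n + 1)%N | i <- index_iota 1 (k n).+1].
  rewrite (_ : (fun n w => _) = (fun n w => Num.sqrt (k n)%:R *
      (((size (L n))%:R^-1 * \sum_(t <- L n) Zhat_sl X b n t w)^-1 -
       ((size (L n))%:R^-1 * \sum_(t <- L n) Yhat_sl X b n t w)^-1))); last first.
    apply/funext => n; apply/funext => w.
    by rewrite /L !big_map size_map size_iota subn1.
  apply: inv_mean_diff_oP1 hE t0 d0 hA3 hA4 hA5 hA6 _ => // n /nbk nE n0.
  have k0 : (0 < k n)%N by move: n0; rewrite [X in (_ < X)%N]nE muln_gt0 => /andP[].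
  split; first by rewrite -size_eq0 size_map size_iota subn1 -lt0n.
  move=> t /mapP[i]; rewrite mem_index_iota => /andP[i1 ik] ->; rewrite addn1; split => //.
  rewrite addSn ltnS -mulSnr [X in (_ <= X)%N]nE mulnC.
  by rewrite leq_mul2l subn1 prednK// -(ltnS i) ik orbT.
(* The last sliding block starts at [n - b + 1] and ends exactly at [n]. *)
- pose L n := index_iota 1 (n - b n + 1).+1.
  rewrite (_ : (fun n w => _) = (fun n w => Num.sqrt (k n)%:R *
      (((size (L n))%:R^-1 * \sum_(t <- L n) Zhat_sl X b n t w)^-1 -
       ((size (L n))%:R^-1 * \sum_(t <- L n) Yhat_sl X b n t w)^-1))); last first.
    by apply/funext => n; apply/funext => w; rewrite /L size_iota subn1.
  apply: inv_mean_diff_oP1 hE t0 d0 hA3 hA4 hA5 hA6 _ => // n /nbk nE n0.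
  split; first by rewrite -size_eq0 size_iota subn1 addn1.
  have bn : (b n <= n)%N.
    have k0 : (0 < k n)%N by move: n0; rewrite [X in (_ < X)%N]nE muln_gt0 => /andP[].
    by rewrite [X in (_ <= X)%N]nE leq_pmulr.
  by move=> t; rewrite mem_index_iota => /andP[t1]; move: (b n) bn => B; clear -t1; lia.
Qed.
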